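(* Let $A\models\mathbb R\mathsf{-OVSA}$ and let $h=\min(f_0,\ldots,f_{n-1})$ (with $n\ge 1$) for some $\sigma$-polynomials $f_0,\ldots,f_{n-1}$ over $A$. Suppose $a,b\in A$ with $a<b$ are such that $h$ changes sign between $a$ and $b$. Then there is an extension $B\supseteq A$, $B\models\mathbb R\mathsf{-OVSA}$, in which there is a zero of $h$ between $a$ and $b$. Equivalently, if $M\models\mathbb R\mathsf{-OVSA}$ is existentially closed, then every function $h\colon M\to M$ that is a minimum of finitely many $\sigma$-polynomials over $M$ has the Intermediate Value Property on $M$.
   Context: An ordered $\mathbb R$-vector space is a linearly ordered abelian group (with $x<y\Rightarrow x+z<y+z$) which is also an $\mathbb R$-vector space in such a way that multiplication by positive scalars preserves signs. $\mathbb R\mathsf{-OVSA}$ is the theory of (possibly trivial) ordered $\mathbb R$-vector spaces equipped with an $\mathbb R$-linear strictly increasing bijection $\sigma$ and its inverse, in the language $L_{\mathbb R,\sigma}=\{+,0,-,<\}\cup\{\lambda\cdot-:\lambda\in\mathbb R\}\cup\{\sigma,\sigma^{-1}\}$. Extensions are taken in this language, so $\sigma_B$ extends $\sigma_A$. A $\sigma$-polynomial over $A$ is a function of the form $x\mapsto d+\sum_{i\le k}\lambda_i\sigma^i(x)$ with $k\in\omega$, $\lambda_i\in\mathbb R$ and $d\in A$; it makes sense on $A$ and on every extension of $A$. The function $h$ is the pointwise minimum. ''$h$ changes sign between $a$ and $b$'' means that one of $h(a),h(b)$ is positive and the other negative. $M\models\mathbb R\mathsf{-OVSA}$ is existentially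 closed if for every quantifier-free $L_{\mathbb R,\sigma}$-formula $\varphi(x,y)$ ($x$, $y$ finite tuples of variables) and every tuple $a$ from $M$, if some $B\models\mathbb R\mathsf{-OVSA}$ with $B\supseteq M$ contains a tuple $b$ with $B\models\varphi(a,b)$, then there is a tuple $m$ in $M$ with $M\models\varphi(a,m)$. A function $M\to M$ has the Intermediate Value Property (IVP) if it maps convex sets to convex sets. *)

(* Defs.v *)
From HB Require Import structures.
From mathcomp Require Import all_boot all_order all_algebra.
From mathcomp Require Import classical_sets reals.

Set Implicit Arguments.
Unset Strict Implicit.
Unset Printing Implicit Defensive.

Import Order.TTheory GRing.Theory Num.Theory.
Local Open Scope ring_scope.

(* Linearity of the order is an axiom of the mixin instead of an orderType
   structure because joining Order.Total with GRing.Lmodule would need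
   structures missing from the existing hierarchy.
   The trivial space is allowed. *)
HB.mixin Record isOrderedVS (R : realType) V
    of GRing.Lmodule R V & Num.POrderedZmodule V := {
  ovs_total : total (<=%R : rel V);
  ovs_ltD2r : forall x y z : V, x < y -> x + z < y + z;
  ovs_scale_gt0 : forall (c : R) (x : V), 0 < c -> 0 < x -> 0 < c *: x;
  ovs_scale_lt0 : forall (c : R) (x : V), 0 < c -> x < 0 -> c *: x < 0
}.

#[short(type="ovsType")]
HB.structure Definition OrderedVS (R : realType) :=
  { V of GRing.Lmodule R V & Num.POrderedZmodule V & isOrderedVS R V }.

HB.mixin Record hasSigma (R : realType) V of OrderedVS R V := {
  sigma : V -> V;
  sigmaV : V -> V;
  sigma_linear : linear sigma;
  sigma_lt : {homo sigma : x y / x < y};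
  sigmaK : cancel sigma sigmaV;
  sigmaVK : cancel sigmaV sigma
}.

#[short(type="ovsaType")]
HB.structure Definition OVSA (R : realType) :=
  { V of OrderedVS R V & hasSigma R V }.

(* Extensions are represented by embeddings for the full language. *)
Record is_embedding (R : realType) (A B : ovsaType R) (i : A -> B) : Prop :=
  IsEmbedding {
    embedding_linear : linear i;
    embedding_lt : {mono i : x y / x < y};
    embedding_sigma : {morph i : x / sigma x};
    embedding_sigmaV : {morph i : x / sigmaV x}
  }.

(* A sigma-polynomial is kept as a formal expression, since it has to be
   evaluated both in the base structure and in its extensions. *)
Record sigma_poly (R : realType) (A : Type) := SigmaPoly {
  sp_deg : nat;
  sp_coef : 'I_sp_deg.+1 -> R;
  sp_const : A
}.

Definition sp_map (R : realType) (A B : Type) (i : A -> B)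
    (f : sigma_poly R A) : sigma_poly R B :=
  SigmaPoly (@sp_coef R A f) (i (sp_const f)).

Definition sp_eval (R : realType) (A : ovsaType R) (f : sigma_poly R A)
    (x : A) : A :=
  sp_const f + \sum_(j < (sp_deg f).+1) sp_coef j *: iter j sigma x.

(* There are n.+1 polynomials, so that the minimum is never empty; repeating
   the value at ord0 as the default is harmless since min is idempotent. *)
Definition min_sp (R : realType) (A : ovsaType R) (n : nat)
    (f : 'I_n.+1 -> sigma_poly R A) (x : A) : A :=
  \big[Order.min/sp_eval (f ord0) x]_(j < n.+1) sp_eval (f j) x.

Definition changes_sign (R : realType) (A : ovsaType R) (h : A -> A)
    (a b : A) : Prop :=
  (0 < h a /\ h b < 0) \/ (h a < 0 /\ 0 < h b).

Definition order_convex (R : realType) (A : ovsaType R) (C : set A) : Prop :=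
  forall x y z : A, C x -> C y -> x <= z <= y -> C z.

Definition IVP (R : realType) (A : ovsaType R) (h : A -> A) : Prop :=
  forall C : set A, order_convex C -> order_convex (image C h).

Inductive term (R : realType) (X : Type) : Type :=
| TVar of X
| TZero
| TAdd of term R X & term R X
| TOpp of term R X
| TScale of R & term R X
| TSigma of term R X
| TSigmaV of term R X.

Inductive qf_formula (R : realType) (X : Type) : Type :=
| FEq of term R X & term R X
| FLt of term R X & term R X
| FNot of qf_formula R X
| FAnd of qf_formula R X & qf_formula R X
| FOr of qf_formula R X & qf_formula R X.

Fixpoint term_eval (R : realType) (X : Type) (A : ovsaType R) (e : X -> A)
    (t : term R X) : A :=
  match t with
  | TVar v => e v
  | TZero => 0
  | TAdd t1 t2 => term_eval e t1 + term_eval e t2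
  | TOpp t1 => - term_eval e t1
  | TScale c t1 => c *: term_eval e t1
  | TSigma t1 => sigma (term_eval e t1)
  | TSigmaV t1 => sigmaV (term_eval e t1)
  end.

Fixpoint qf_holds (R : realType) (X : Type) (A : ovsaType R) (e : X -> A)
    (phi : qf_formula R X) : Prop :=
  match phi with
  | FEq t1 t2 => term_eval e t1 = term_eval e t2
  | FLt t1 t2 => term_eval e t1 < term_eval e t2
  | FNot phi1 => ~ qf_holds e phi1
  | FAnd phi1 phi2 => qf_holds e phi1 /\ qf_holds e phi2
  | FOr phi1 phi2 => qf_holds e phi1 \/ qf_holds e phi2
  end.

(* Valuation of the variables x (indexed by 'I_p) and y (indexed by 'I_q). *)
Definition env (T : Type) (p q : nat) (x : p.-tuple T) (y : q.-tuple T)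
    (v : 'I_p + 'I_q) : T :=
  match v with
  | inl j => tnth x j
  | inr j => tnth y j
  end.

Definition existentially_closed (R : realType) (M : ovsaType R) : Prop :=
  forall (p q : nat) (phi : qf_formula R ('I_p + 'I_q)) (a : p.-tuple M),
    (exists (B : ovsaType R) (i : M -> B),
       is_embedding i /\
       exists b : q.-tuple B, qf_holds (env (map_tuple i a) b) phi) ->
    exists m : q.-tuple M, qf_holds (env a m) phi.

(* Main.v *)
Require Import Defs.
From HB Require Import structures.
From mathcomp Require Import all_boot all_order all_algebra.
From mathcomp Require Import boolp classical_sets reals.
From mathcomp Require Import polyrcf.
From mathcomp Require Import ring.

Set Implicit Arguments.
Unset Strict Implicit.
Unset Printing Implicit Defensive.

Import Order.TTheory GRing.Theory Num.Theory.
Local Open Scope ring_scope.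

(** Let sigma act as the variable 'X.  Then an ordered space A with its
    automorphism is an ordered module over the polynomials, and a
    sigma-polynomial becomes an affine function x |-> d + p x.  Measured
    from the end point of the interval where the minimum is positive, the first
    claim reads as follows (extension_with_zero).  Given c > 0, finitely
    many b k > 0 and polynomials p k such that b l - p l c < 0 for some l, there
    is, in some extension, a y between 0 and c for which all b k - p k y are
    nonnegative and one of them vanishes.

    Extensions are made from cones.  In the module of pairs formed by an element
    of A and a rational function, (0, 1) plays the part of y.  For an index j,
    consider the cone generated, under polynomials with nonnegative coefficients
    and under division by 'X, by the positive elements of A and by
    b k - p k y for all k, by - (b j - p j y), y and c - y.  If this cone contains
    no negative element of A, Zorn's lemma makes it total: when neither v nor - v
    can be adjoined, cross-multiplying the two relations that prevent it puts a
    negative element of A into the cone (total_cone_exists).  Dividing by the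
    elements that are both nonnegative and nonpositive gives the extension
    (cone_quotient).

    Suppose that this fails for every j with p j <> 0; constant functions are
    positive and stay so.  Then for every such j there is an identity
      r j (b j - p j y)
        = a j + sum_k q j k (b k - p k y) + s j (c - y) + t j y
    with a j > 0 in A and coefficients that are polynomials with nonnegative
    coefficients.  It remains to show that these identities force
    b j - p j c > 0 for all j (certificate_strictly), against the choice of l.

    If 'X acted as a positive real number, the identities would say that no y in
    [0, c] is a zero of the minimum, and the intermediate value theorem for
    affine functions would finish the proof.  In general 'X acts by scalars only
    to first order: up to elements negligible with respect to a given x > 0, it
    acts as a positive real number or as an infinitely large or infinitely small
    one, so that each polynomial acts with a sign (level_exists).  At the level
    of c, a maximum principle for the ratios p k / b k (max_principle) treats all
    indices except those from which the relation q j k <> 0 never leads to a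
    nonzero s, or never to a nonzero t.

    These remaining indices need all levels at once, and there it matters that
    the coefficients are polynomials: a relation r p = q p + s whose index set
    cannot be made smaller propagates p > 0 from one positive real number to all
    of them, because the zeros of the p j at a first bad point would form a
    smaller index set (irreducible_posp, slopes_posp).  Once the p j are positive
    on the half-line, Gaussian elimination works with coefficients that are
    positive on the half-line, hence act positively at every level, and it
    yields the sign of b j - p j c (elimination).

    The second claim follows from the first, since having a zero of the minimum
    between two points is a quantifier-free property of that zero. *)

(** * Normal forms of linear combinations *)

(** Formal linear combinations of vectors.  Comparing coefficients reduces an
    identity between vectors to identities in the ring of scalars; lmod_eq
    does this, and hands the latter to ring. *)
Section LinearNormalForm.
Variables (K : nzRingType) (V : lmodType K).

Inductive lterm : Type :=
| LVar of nat
| LZero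
| LAdd of lterm & lterm
| LOpp of lterm
| LScale of K & lterm.

Fixpoint leval (env : seq V) (t : lterm) : V :=
  match t with
  | LVar j => env`_j
  | LZero => 0
  | LAdd t1 t2 => leval env t1 + leval env t2
  | LOpp t1 => - leval env t1
  | LScale c t1 => c *: leval env t1
  end.

Fixpoint lcoef (t : lterm) (i : nat) : K :=
  match t with
  | LVar j => if Nat.eqb j i then 1 else 0
  | LZero => 0
  | LAdd t1 t2 => lcoef t1 i + lcoef t2 i
  | LOpp t1 => - lcoef t1 i
  | LScale c t1 => c * lcoef t1 i
  end.

Lemma leval_lcoef env t :
  leval env t = \sum_(i < size env) lcoef t i *: env`_i.
Proof.
elim: t => [j||t1 IH1 t2 IH2|t IH|c t IH] /=; rewrite ?IH1 ?IH2 ?IH.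
- have [lt|ge] := ltnP j (size env).
    rewrite (bigD1 (Ordinal lt)) //= PeanoNat.Nat.eqb_refl scale1r big1 ?addr0 // => i ne.
    case: (PeanoNat.Nat.eqb_spec j i) => [e|_]; last by rewrite scale0r.
    by move: ne; rewrite -val_eqE /= e eqxx.
  rewrite nth_default // big1 // => i _.
  case: (PeanoNat.Nat.eqb_spec j i) => [e|_]; last by rewrite scale0r.
  by have := ltn_ord i; rewrite -e ltnNge ge.
- by rewrite big1 // => i _; rewrite scale0r.
- by rewrite -big_split; apply: eq_bigr => i _; rewrite scalerDl.
- by rewrite -sumrN; apply: eq_bigr => i _; rewrite scaleNr.
- by rewrite scaler_sumr; apply: eq_bigr => i _; rewrite scalerA.
Qed.

Fixpoint same_lcoef (t1 t2 : lterm) (n : nat) : Prop :=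
  if n is n'.+1 then lcoef t1 n' = lcoef t2 n' /\ same_lcoef t1 t2 n' else True.

Lemma same_lcoef_leval env t1 t2 :
  same_lcoef t1 t2 (size env) -> leval env t1 = leval env t2.
Proof.
move=> h; rewrite !leval_lcoef; elim: (size env) h => [|n IH]; first by rewrite !big_ord0.
by case=> e /IH s; rewrite !big_ord_recr /= e s.
Qed.

End LinearNormalForm.

(** Atoms are compared up to conversion, since equal vectors may be displayed
    through different structures. *)
Ltac lmod_index v env :=
  lazymatch env with
  | ?w :: ?e =>
    match constr:(0%N) with
    | _ => let _ := match constr:(0%N) with _ => unify v w end in constr:(0%N)
    | _ => let n := lmod_index v e in constr:(S n)
    end
  end.

Ltac lmod_atoms env t :=
  lazymatch t with
  | 0 => env
  | ?a + ?b => let e := lmod_atoms env a in lmod_atoms e b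
  | - ?a => lmod_atoms env a
  | ?c *: ?a => lmod_atoms env a
  | ?a => match env with
          | _ => let n := lmod_index a env in env
          | _ => constr:(a :: env)
          end
  end.

Ltac lmod_reify env t :=
  lazymatch t with
  | 0 => uconstr:(LZero _)
  | ?a + ?b => let x := lmod_reify env a in let y := lmod_reify env b in
               uconstr:(LAdd x y)
  | - ?a => let x := lmod_reify env a in uconstr:(LOpp x)
  | ?c *: ?a => let x := lmod_reify env a in uconstr:(LScale c x)
  | ?a => let n := lmod_index a env in uconstr:(LVar _ n)
  end.

Ltac lmod_eq :=
  lazymatch goal with
  | |- @eq ?T ?a ?b =>
    let e := lmod_atoms (@nil T) a in
    let e := lmod_atoms e b in
    let x := lmod_reify e a in
    let y := lmod_reify e b in
    refine (@same_lcoef_leval _ _ e x y _);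
    cbn [same_lcoef size lcoef Nat.eqb]; repeat split; ring
  end.

Ltac lmod_exact h :=
  lazymatch goal with |- ?C ?b =>
  lazymatch type of h with _ ?a =>
    let e := fresh in have e : b = a; [lmod_eq | rewrite e; exact h]
  end end.

(** * Polynomials that are positive on the half-line *)
Section Positivity.
Variable R : realType.
Implicit Types (g h p q : {poly R}).

Definition nonneg_coef g := forall i, 0 <= g`_i.
(** By Polya's theorem, these are the polynomials that are quotients of nonzero
    polynomials with nonnegative coefficients; hence they act positively on every
    ordered module. *)
Definition posp g := forall t : R, 0 < t -> 0 < g.[t].
Definition nnp g := g = 0 \/ posp g.

Lemma nonneg_coef0 : nonneg_coef 0.
Proof. by move=> i; rewrite coef0. Qed.

Lemma nonneg_coefC (c : R) : 0 <= c -> nonneg_coef c%:P.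
Proof. by move=> c0 i; rewrite coefC; case: ifP. Qed.

Lemma nonneg_coefX : nonneg_coef 'X.
Proof. by move=> i; rewrite coefX; case: eqP. Qed.

Lemma nonneg_coefD g h : nonneg_coef g -> nonneg_coef h -> nonneg_coef (g + h).
Proof. by move=> g0 h0 i; rewrite coefD addr_ge0. Qed.

Lemma nonneg_coefM g h : nonneg_coef g -> nonneg_coef h -> nonneg_coef (g * h).
Proof. by move=> g0 h0 i; rewrite coefM sumr_ge0 // => j _; rewrite mulr_ge0. Qed.

Lemma nonneg_coefXn n : nonneg_coef ('X^n).
Proof. by move=> i; rewrite coefXn ler0n. Qed.

Lemma nonneg_coef_nnp g : nonneg_coef g -> nnp g.
Proof.
move=> g0; have [->|gn0] := eqVneq g 0; [by left | right => t t0].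
rewrite horner_coef.
have /prednK sz : (0 < size g)%N by rewrite size_poly_gt0.
rewrite -sz big_ord_recr /=; apply: ltr_wpDl.
  by apply: sumr_ge0 => i _; rewrite mulr_ge0 // exprn_ge0 // ltW.
rewrite mulr_gt0 ?exprn_gt0 // lt_neqAle g0 andbT eq_sym.
by rewrite -lead_coefE lead_coef_eq0.
Qed.

Lemma posp_neq0 g : posp g -> g != 0.
Proof. by move=> /(_ 1 ltr01) g1; apply/eqP => g0; rewrite g0 horner0 ltxx in g1. Qed.

Lemma nnp0 : nnp 0. Proof. by left. Qed.

Lemma nnp_posp g : nnp g -> g != 0 -> posp g.
Proof. by case=> // ->; rewrite eqxx. Qed.

Lemma nnp_ge0 g t : nnp g -> 0 < t -> 0 <= g.[t].
Proof. by case=> [->|h] t0; [rewrite horner0 | exact/ltW/h]. Qed.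

Lemma pospM g h : posp g -> posp h -> posp (g * h).
Proof. by move=> g0 h0 t t0; rewrite hornerM mulr_gt0 ?g0 ?h0. Qed.

Lemma posp_nnpD g h : posp g -> nnp h -> posp (g + h).
Proof. by move=> g0 h0 t t0; rewrite hornerD ltr_wpDr ?g0 ?nnp_ge0. Qed.

Lemma nnpD g h : nnp g -> nnp h -> nnp (g + h).
Proof. by case=> [->|g0] h0; [rewrite add0r | right; exact: posp_nnpD]. Qed.

Lemma nnpM g h : nnp g -> nnp h -> nnp (g * h).
Proof.
case=> [->|g0]; first by rewrite mul0r; left.
by case=> [->|h0]; [rewrite mulr0; left | right; exact: pospM].
Qed.

Lemma nnp_sum (I : finType) (P : pred I) (F : I -> {poly R}) :
  (forall i, P i -> nnp (F i)) -> nnp (\sum_(i | P i) F i).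
Proof. by move=> F0; elim/big_ind: _ => //; [left | exact: nnpD]. Qed.

Lemma nnpD_eq0 g h : nnp g -> nnp h -> g + h = 0 -> g = 0 /\ h = 0.
Proof.
case=> [->|g0] h0; first by rewrite add0r.
by move=> gh; have := posp_neq0 (posp_nnpD g0 h0); rewrite gh eqxx.
Qed.

Lemma nnp_sum_eq0 (I : finType) (P : pred I) (F : I -> {poly R}) :
  (forall i, P i -> nnp (F i)) -> \sum_(i | P i) F i = 0 ->
  forall i, P i -> F i = 0.
Proof.
move=> F0 s0 i Pi; rewrite (bigD1 i) //= in s0.
by have [] := nnpD_eq0 (F0 _ Pi) (nnp_sum (fun j jP => F0 j (proj1 (andP jP)))) s0.
Qed.

End Positivity.

(** * Invariant cones *)

(** A preorder on the module is given by its cone C of nonnegative elements: x is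
    below y when C (y - x).  The cones are invariant under 'X and under its
    inverse, as 'X acts by an automorphism of the order. *)
Section Cones.
Variables (R : realType) (V : lmodType {poly R}).
Implicit Types (C : V -> Prop) (x y m : V) (g h : {poly R}) (c : R).

Lemma scaler_comm g h x : g *: (h *: x) = h *: (g *: x).
Proof. by rewrite !scalerA mulrC. Qed.

Record cone C : Prop := Cone {
  cone0 : C 0;
  coneD : forall x y, C x -> C y -> C (x + y);
  coneC : forall c x, 0 <= c -> C x -> C (c%:P *: x);
  coneX : forall x, C ('X *: x) <-> C x
}.

Record total_cone C : Prop := TotalCone {
  total_cone_cone :> cone C;
  cone_total : forall x, C x \/ C (- x)
}.

(** For a total cone, this says that x is positive. *)
Definition strictly C x := ~ C (- x).

Lemma coneXn C n x : cone C -> C ('X^n *: x) <-> C x.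
Proof.
move=> hC; elim: n => [|n IH]; first by rewrite expr0 scale1r.
by rewrite exprS -scalerA (coneX hC).
Qed.

Lemma coneZ C g x : cone C -> nonneg_coef g -> C x -> C (g *: x).
Proof.
move=> hC g0 Cx; rewrite -[g]coefK poly_def scaler_suml.
apply: big_ind => [|y z|i _]; [exact: cone0 | exact: coneD |].
rewrite -mul_polyC -scalerA; apply: coneC => //.
exact/coneXn.
Qed.

Lemma cone_null C g x : cone C -> C x -> C (- x) -> C (g *: x).
Proof.
move=> hC Cx CNx; elim/poly_ind: g => [|g c IH].
  by rewrite scale0r; exact: cone0.
rewrite scalerDl mulrC -scalerA; apply: (coneD hC); first exact/(coneX hC).
have [c0|/ltW c0] := leP 0 c; first exact: (coneC hC).
by rewrite -[c]opprK polyCN scaleNr -scalerN; apply: (coneC hC); rewrite ?oppr_ge0.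
Qed.

Lemma cone_sum C (I : finType) (P : pred I) (F : I -> V) :
  cone C -> (forall i, P i -> C (F i)) -> C (\sum_(i | P i) F i).
Proof.
by move=> hC F0; apply: big_ind => //; [exact: cone0 | exact: coneD].
Qed.

Lemma strictlyW C x : total_cone C -> strictly C x -> C x.
Proof. by move=> hC sx; case: (cone_total hC x). Qed.

Lemma strictlyD C x y : total_cone C -> strictly C x -> C y -> strictly C (x + y).
Proof.
move=> hC sx Cy Cxy; apply: sx.
by have := coneD hC Cxy Cy; rewrite opprD subrK.
Qed.

Lemma coneCV C c x : cone C -> 0 < c -> C (c%:P *: x) -> C x.
Proof.
move=> hC c0 /(coneC hC (c := c^-1)); rewrite invr_ge0 ltW // => /(_ isT).
by rewrite scalerA -polyCM mulVf ?gt_eqF // scale1r.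
Qed.

Lemma strictlyXn C n x : cone C -> strictly C ('X^n *: x) <-> strictly C x.
Proof. by move=> hC; rewrite /strictly -scalerN (coneXn _ _ hC). Qed.

Lemma cone_trans C y x z : cone C -> C (y - x) -> C (z - y) -> C (z - x).
Proof. by move=> hC h1 h2; have := coneD hC h2 h1; rewrite addrA subrK. Qed.

Lemma strictly_mono C x c d : total_cone C -> strictly C x ->
  C (c%:P *: x - d%:P *: x) -> d <= c.
Proof.
move=> hC sx; rewrite -scalerBl -polyCB leNgt => h; apply/negP => cd.
apply: sx; apply: (coneCV hC (c := d - c)); first by rewrite subr_gt0.
by rewrite scalerN -scaleNr -polyCN opprB.
Qed.

Lemma cone_le C x c d : cone C -> C x -> c <= d -> C (d%:P *: x - c%:P *: x).
Proof. 
by move=> hC Cx cd; rewrite -scalerBl -polyCB; apply: coneC => //; rewrite subr_ge0.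
Qed.

End Cones.

(** * Levels *)
Section Level.
Variables (R : realType) (V : lmodType {poly R}).
Implicit Types (C : V -> Prop) (x y m : V) (g : {poly R}) (c : R).

(** How 'X looks to an observer of size x.  The elements of hull are bounded in
    terms of x; lcone orders them up to elements that are negligible with respect
    to x.  Modulo the latter, a polynomial g acts on the hull with the sign of the
    real number sg g: its value at a real number, its leading coefficient, or its
    lowest one.  The field sg_real records that finitely many such signs can be
    read at one positive real number. *)
Record level C (x : V) := Level {
  sg : {poly R} -> R;
  hull : V -> Prop;
  lcone : V -> Prop;
  sg_real : forall s : seq {poly R}, exists2 t : R, 0 < t &
    forall g, g \in s -> Num.sg g.[t] = Num.sg (sg g);
  hull_base : hull x;
  hullD : forall m n, hull m -> hull n -> hull (m + n);
  hullZ : forall g m, hull m -> hull (g *: m);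
  hullXV : forall m, hull ('X *: m) -> hull m;
  hull_le : forall m n, C m -> C (n - m) -> hull n -> hull m;
  lcone_total : total_cone lcone;
  lconeW : forall m, C m -> lcone m;
  lcone_base : strictly lcone x;
  lconeZ : forall g m, 0 <= sg g -> hull m -> lcone m -> lcone (g *: m);
  lconeZV : forall g m, 0 < sg g -> hull m -> lcone (g *: m) -> lcone m
}.

Arguments lcone_base {C x} l _.

(** A level at which 'X is multiplication by the real number tau. *)
Section At.
Variables (C : V -> Prop) (hC : total_cone C) (x : V) (sx : strictly C x).
Variables (tau : R) (tau0 : 0 < tau).
Let Cx : C x := strictlyW hC sx.

Definition bounded_by (K : R) m := C (K%:P *: x - m) /\ C (K%:P *: x + m).
Definition negligible m := forall e, 0 < e -> bounded_by e m.

Hypothesis Xx : negligible ('X *: x - tau%:P *: x).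

Lemma bounded_byD K L m n :
  bounded_by K m -> bounded_by L n -> bounded_by (K + L) (m + n).
Proof.
move=> [a b] [a' b']; split; rewrite polyCD scalerDl.
  by rewrite opprD addrACA; exact: (coneD hC).
by rewrite addrACA; exact: (coneD hC).
Qed.

Lemma bounded_byN K m : bounded_by K m -> bounded_by K (- m).
Proof. by case=> a b; split; rewrite ?opprK. Qed.

Lemma bounded_by_le K L m : K <= L -> bounded_by K m -> bounded_by L m.
Proof.
move=> KL [a b]; have h := cone_le hC Cx KL; split.
  by have := coneD hC h a; rewrite addrA subrK.
by have := coneD hC h b; rewrite addrA subrK.
Qed.

Lemma bounded_byC K c m : 0 < c -> bounded_by K m -> bounded_by (c * K) (c%:P *: m).
Proof.
move=> c0 [a b]; split; rewrite polyCM -scalerA -?scalerBr -?scalerDr;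
  exact: (coneC hC (ltW c0)).
Qed.

Lemma bounded_by0 K : 0 <= K -> bounded_by K 0.
Proof. by move=> K0; split; rewrite ?subr0 ?addr0; exact: (coneC hC). Qed.

Lemma bounded_byCr K c m : 0 <= K -> bounded_by K m ->
  bounded_by ((`|c| + 1) * K) (c%:P *: m).
Proof.
move=> K0 bm; have cc : `|c| * K <= (`|c| + 1) * K by rewrite ler_wpM2r // lerDl.
have [c0|c0|->] := ltgtP c 0.
- apply: (bounded_by_le cc); rewrite ltr0_norm //.
  rewrite -[c in c%:P]opprK polyCN scaleNr; apply: bounded_byN.
  by apply: bounded_byC; rewrite // oppr_gt0.
- by apply: (bounded_by_le cc); rewrite gtr0_norm //; exact: bounded_byC.
by rewrite scale0r; apply: bounded_by0; rewrite mulr_ge0 // addr_ge0.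
Qed.

Lemma X_ub : C ((tau + 1)%:P *: x - 'X *: x).
Proof.
have [h _] := Xx ltr01.
by rewrite [tau + 1]addrC polyCD scalerDl -addrA -opprB.
Qed.

Lemma X_lb : C ('X *: x - (tau / 2)%:P *: x).
Proof.
have [_ h] := Xx (divr_gt0 tau0 (ltr0Sn R 1)).
rewrite addrCA -scalerBl -polyCB in h.
rewrite -scaleNr -polyCN; move: h; congr (C (_ + _%:P *: _)).
by rewrite {2}[tau]splitr opprD addrA subrr add0r.
Qed.

Lemma bounded_byX K m : 0 <= K -> bounded_by K m ->
  bounded_by (K * (tau + 1)) ('X *: m).
Proof.
move=> K0 [a b].
have hK : C ((K * (tau + 1))%:P *: x - 'X *: (K%:P *: x)).
  rewrite ['X *: _]scaler_comm polyCM -[X in C (X - _)]scalerA -scalerBr.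
  by apply: (coneC hC) => //; exact: X_ub.
split.
  by apply: (cone_trans hC _ hK); rewrite -scalerBr (coneX hC).
rewrite -[X in _ + X]opprK -scalerN; apply: (cone_trans hC _ hK).
by rewrite -scalerBr (coneX hC) opprK.
Qed.

Lemma bounded_byXV K m : 0 <= K -> bounded_by K ('X *: m) ->
  bounded_by (K * (tau / 2)^-1) m.
Proof.
have e0 : 0 < tau / 2 by rewrite divr_gt0.
have {}h : C ('X *: ((tau / 2)^-1%:P *: x) - x).
  apply: (coneCV hC e0); rewrite scalerBr scaler_comm.
  rewrite [X in 'X *: X]scalerA -polyCM divff ?gt_eqF // polyC1 scale1r.
  exact: X_lb.
move=> K0 [a b].
have hK : C ('X *: ((K * (tau / 2)^-1)%:P *: x) - K%:P *: x).
  rewrite polyCM -[X in 'X *: X]scalerA scaler_comm -scalerBr.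
  exact: (coneC hC).
split; apply/(coneX hC).
  rewrite scalerBr; exact: (cone_trans hC a hK).
rewrite scalerDr -[X in _ + X]opprK; apply: (cone_trans hC _ hK).
by rewrite opprK.
Qed.

Lemma negligible0 : negligible 0.
Proof. by move=> e e0; apply: bounded_by0; exact: ltW. Qed.

Lemma negligibleD m n : negligible m -> negligible n -> negligible (m + n).
Proof.
by move=> a b e e0; rewrite [e]splitr; apply: bounded_byD; [apply: a|apply: b];
  rewrite divr_gt0.
Qed.

Lemma negligibleN m : negligible m -> negligible (- m).
Proof. by move=> a e e0; apply/bounded_byN/a. Qed.

Lemma negligibleC c m : negligible m -> negligible (c%:P *: m).
Proof.
move=> a e e0; have c1 : 0 < `|c| + 1 by rewrite ltr_wpDl.
have d0 : 0 < e / (`|c| + 1) by rewrite divr_gt0.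
have := bounded_byCr c (ltW d0) (a _ d0).
by rewrite mulrC divfK // gt_eqF.
Qed.

Lemma negligibleX m : negligible m -> negligible ('X *: m).
Proof.
move=> a e e0; have c1 : 0 < tau + 1 by rewrite addr_gt0.
have d0 : 0 < e / (tau + 1) by rewrite divr_gt0.
by have := bounded_byX (ltW d0) (a _ d0); rewrite divfK // gt_eqF.
Qed.

Lemma negligibleZ g m : negligible m -> negligible (g *: m).
Proof.
move=> a; elim/poly_ind: g => [|g c IH]; first by rewrite scale0r; exact: negligible0.
rewrite scalerDl mulrC -scalerA; apply: negligibleD; last exact: negligibleC.
exact: negligibleX.
Qed.

(** The real number is the supremum of the l for which l x is below m. *)
Lemma bounded_standard_part K m : bounded_by K m ->
  exists l : R, negligible (m - l%:P *: x).
Proof.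
move=> [a b]; pose S : set R := [set l | C (m - l%:P *: x)]%classic.
have S0 : (S !=set0)%classic by exists (- K); rewrite /S /= polyCN scaleNr opprK addrC.
have Sub : ubound S K.
  by move=> l Sl; apply: (strictly_mono hC sx); exact: (cone_trans hC Sl a).
have Ssup : has_sup S by split => //; exists K.
exists (sup S) => e e0; split.
  rewrite opprB addrA -scalerDl -polyCD; case: (cone_total hC (m - (e + sup S)%:P *: x)).
    move=> /(ub_le_sup (ex_intro _ K Sub)).
    by rewrite gerDr leNgt e0.
  by rewrite opprB.
have [l Sl /ltW lt] := sup_adherent e0 Ssup.
have := coneD hC Sl (cone_le hC Cx lt); rewrite addrA subrK.
by rewrite polyCB scalerBl opprB addrCA.
Qed.

Lemma at_level : level C x.
Proof.
pose H m := exists2 K, 0 <= K & bounded_by K m.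
pose L m := forall e, 0 < e -> C (e%:P *: x + m).
have LD m n : L m -> L n -> L (m + n).
  move=> a b e e0; rewrite [e]splitr polyCD scalerDl addrACA.
  by apply: (coneD hC); [apply: a|apply: b]; rewrite divr_gt0.
have LC c m : 0 < c -> L m -> L (c%:P *: m).
  move=> c0 a e e0; have /(coneC hC (ltW c0)) := a _ (divr_gt0 e0 c0).
  by rewrite scalerDr scalerA -polyCM mulrC divfK // gt_eqF.
have LN m : negligible m -> L m by move=> a e e0; case: (a e e0).
have LX m : L ('X *: m) <-> L m.
  split=> a e e0; first last.
    have d0 : 0 < e / (tau + 1) by rewrite divr_gt0 // addr_gt0.
    have := a _ d0; rewrite -(coneX hC) scalerDr => h.
    have := coneD hC (coneC hC (ltW d0) X_ub) h.
    rewrite scalerBr ['X *: (_ *: x)]scaler_comm addrA subrK.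
    by rewrite scalerA -polyCM divfK // gt_eqF // addr_gt0.
  apply/(coneX hC); rewrite scalerDr.
  have d0 : 0 < e * (tau / 2) by rewrite mulr_gt0 // divr_gt0.
  have := coneD hC (a _ d0) (coneC hC (ltW e0) X_lb).
  rewrite scalerBr [X in _ - X]scalerA -polyCM ['X *: (_ *: x)]scaler_comm.
  by rewrite addrC addrA subrK.
have LT : total_cone L.
  split; first split => //.
  - exact/LN/negligible0.
  - move=> c m; rewrite le_eqVlt => /predU1P[<-|]; last exact: LC.
    by move=> _; rewrite scale0r; exact/LN/negligible0.
  - move=> m; have [|/existsNP[e /not_implyP[e0 ne]]] := pselect (L m); first by left.
    right=> d d0; have [/ne//|h] := cone_total hC (e%:P *: x + m).
    have {}h : C (- m).
      have := coneD hC h (coneC hC (ltW e0) Cx).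
      by rewrite opprD addrAC addNr add0r.
    by apply: (coneD hC) => //; apply: (coneC hC) => //; exact: ltW.
have Hst m : H m -> exists l, negligible (m - l%:P *: x).
  by case=> K _; exact: bounded_standard_part.
(* X - tau sends the hull to negligible elements, so g may be replaced by its
   value at tau, by the factor theorem *)
have ev g m : H m -> negligible (g *: m - g.[tau]%:P *: m).
  move=> /Hst[l ml].
  have /factor_theorem[h gh] : root (g - g.[tau]%:P) tau.
    by rewrite rootE !hornerE subrr.
  rewrite -scalerBl gh -scalerA; apply: negligibleZ.
  rewrite -[m](subrK (l%:P *: x)) scalerDr; apply: negligibleD.
    exact: negligibleZ.
  by rewrite scaler_comm; apply: negligibleC; rewrite scalerBl.
exists (fun g => g.[tau]) H L => //.
- by move=> s; exists tau.
- exists 1 => //; split; rewrite polyC1 scale1r ?subrr.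
    exact: (cone0 hC).
  exact: (coneD hC).
- by move=> m n [K K0 a] [K' K0' b]; exists (K + K'); [exact: addr_ge0 | exact: bounded_byD].
- move=> g m [K K0 a]; elim/poly_ind: g => [|g c [K' K0' IH]].
    by rewrite scale0r; exists 0 => //; exact: bounded_by0.
  rewrite scalerDl mulrC -scalerA; exists (K' * (tau + 1) + (`|c| + 1) * K).
    by rewrite addr_ge0 // mulr_ge0 // addr_ge0 // ltW.
  by apply: bounded_byD; [exact: bounded_byX | exact: bounded_byCr].
- move=> m [K K0 a]; exists (K * (tau / 2)^-1); last exact: bounded_byXV.
  by rewrite mulr_ge0 // invr_ge0 divr_ge0 // ltW.
- move=> m n Cm Cmn [K K0 [a b]]; exists K => //; split.
    exact: (cone_trans hC Cmn a).
  by apply: (coneD hC) => //; exact: (coneC hC).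
- by move=> m Cm e e0; apply: (coneD hC) => //; apply: (coneC hC) => //; exact: ltW.
- move=> /(_ (1 / 2)) /(_ (divr_gt0 ltr01 (ltr0Sn R 1))).
  rewrite -[X in _ - X]scale1r -polyC1 => /(strictly_mono hC sx).
  by rewrite leNgt ltr_pdivrMr ?ltr0Sn // mul1r ltr1n.
- move=> g m g0 Hm Lm; rewrite -[g *: m](subrK (g.[tau]%:P *: m)).
  by apply: LD; [exact/LN/ev | exact: (coneC LT)].
- move=> g m g0 Hm Lgm; apply: (coneCV LT g0).
  rewrite -[_ *: m](subrK (g *: m)); apply: LD => //.
  by apply: LN; rewrite -opprB; exact/negligibleN/ev.
Qed.

End At.
End Level.
Arguments lcone_base {R V C x} l _.

(** A level at which S, which is 'X or its inverse, is infinitely large: S x exceeds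
    every real multiple of x.  The hull consists of the elements bounded by some
    iterate of x, and m is negligible when all its iterates lie between - x
    and x. *)
Section Germ.
Variables (R : realType) (V : lmodType {poly R}).
Variables (C : V -> Prop) (hC : total_cone C) (x : V) (sx : strictly C x).
Variable S : V -> V.
Hypothesis SD : forall m n, S (m + n) = S m + S n.
Hypothesis SC : forall (c : R) m, S (c%:P *: m) = c%:P *: S m.
Hypothesis CS : forall m, C (S m) <-> C m.
Hypothesis Sx : forall c : R, C (S x - c%:P *: x).
Hypothesis XS : (forall m, S m = 'X *: m) \/ (forall m, S ('X *: m) = m).
Implicit Types (m n : V) (c : R) (g h : {poly R}).

Let Cx : C x := strictlyW hC sx.

Let SN m : S (- m) = - S m.
Proof. have e : -1 = (-1)%:P :> {poly R} by rewrite polyCN polyC1.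
by rewrite -[- m]scaleN1r e SC -e scaleN1r. Qed.

Let iterSD k m n : iter k S (m + n) = iter k S m + iter k S n.
Proof. by elim: k => //= k ->; rewrite SD. Qed.

Let iterSC k c m : iter k S (c%:P *: m) = c%:P *: iter k S m.
Proof. by elim: k => //= k ->; rewrite SC. Qed.

Let iterSN k m : iter k S (- m) = - iter k S m.
Proof. by elim: k => //= k ->; rewrite SN. Qed.

Let CiterS k m : C (iter k S m) <-> C m.
Proof. by elim: k => //= k <-; exact: CS. Qed.

Definition germ_cone m := forall k, C (iter k S m + x).
Definition germ_hull m := exists k, C (iter k S x - m) /\ C (iter k S x + m).

Let not_CNx : ~ C (- x). Proof. exact: sx. Qed.

Lemma germ_coneW m : C m -> germ_cone m.
Proof. by move=> Cm k; apply: (coneD hC) => //; exact/CiterS. Qed.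

Lemma germ_coneD m n : germ_cone m -> germ_cone n -> germ_cone (m + n).
Proof.
move=> a b k; have [//|h] := cone_total hC (iter k S (m + n) + x).
case: not_CNx; move: h; rewrite -CS SN SD -iterS iterSD opprD => h.
have {}h := coneD hC (coneD hC h (coneD hC (a k.+1) (b k.+1))) (Sx (1 + (1 + 1))).
lmod_exact h.
Qed.

Lemma germ_coneS m : germ_cone (S m) <-> germ_cone m.
Proof.
split=> a k; last by rewrite -iterSr; exact: a.
apply/CS; rewrite SD -iterS; have := a k; rewrite -iterSr => h.
have {}h := coneD hC h (Sx 1).
lmod_exact h.
Qed.

Lemma germ_coneC c m : 0 < c -> germ_cone m -> germ_cone (c%:P *: m).
Proof.
move=> c0 a k; rewrite iterSC; apply/CS; rewrite SD SC -iterS.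
have h := coneD hC (coneC hC (ltW c0) (a k.+1)) (Sx c).
lmod_exact h.
Qed.

Lemma germ_cone_total : total_cone germ_cone.
Proof.
split; first split.
- by apply: germ_coneW; exact: (cone0 hC).
- exact: germ_coneD.
- move=> c m; rewrite le_eqVlt => /predU1P[<- _|]; last exact: germ_coneC.
  by rewrite scale0r; apply: germ_coneW; exact: (cone0 hC).
- move=> m; case: XS => h; first by rewrite -h germ_coneS.
  by rewrite -[in X in _ <-> X](h m) germ_coneS.
move=> m; have [|/existsNP[k nk]] := pselect (germ_cone m); first by left.
right; apply: germ_coneW; have [/nk//|h] := cone_total hC (iter k S m + x).
apply/(CiterS k); have {}h := coneD hC h Cx.
rewrite iterSN; lmod_exact h.
Qed.

Lemma germ_cone_base : strictly germ_cone x.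
Proof.
move=> /(_ 1%N) /=; rewrite SN => h; apply: not_CNx.
have {}h := coneD hC h (Sx (1 + 1)); lmod_exact h.
Qed.

Lemma germ_growth_ge1 k c : C (iter k.+1 S x - c%:P *: iter k S x).
Proof. by rewrite iterSr -iterSC -iterSN -iterSD; apply/CiterS. Qed.

Lemma iterS_mono k d : C (iter (k + d) S x - iter k S x).
Proof.
elim: d => [|d IH]; first by rewrite addn0 subrr; exact: (cone0 hC).
rewrite addnS; apply: (cone_trans hC IH).
by have := germ_growth_ge1 (k + d) 1; rewrite polyC1 scale1r.
Qed.

Lemma germ_hull_S m : germ_hull (S m) <-> germ_hull m.
Proof.
split=> [[k [a b]]|[k [a b]]]; exists k.+1; last by rewrite iterS -SN -!SD !CS.
have := iterS_mono k 2; rewrite addn2 => h.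
split; apply/CS; rewrite SD ?SN -iterS.
  have {}h := coneD hC h a; lmod_exact h.
have {}h := coneD hC h b; lmod_exact h.
Qed.

Lemma germ_hullD m n : germ_hull m -> germ_hull n -> germ_hull (m + n).
Proof.
move=> [k [a b]] [l [a' b']]; exists (k + l).+1.
have h := germ_growth_ge1 (k + l) (1 + 1).
have i1 := iterS_mono k l; have i2 := iterS_mono l k; rewrite addnC in i2.
split.
  have {}h := coneD hC h (coneD hC (coneD hC i1 a) (coneD hC i2 a')); lmod_exact h.
have {}h := coneD hC h (coneD hC (coneD hC i1 b) (coneD hC i2 b')); lmod_exact h.
Qed.

Lemma germ_hullC c m : germ_hull m -> germ_hull (c%:P *: m).
Proof.
move=> [k [a b]]; exists k.+1.
have h := germ_growth_ge1 k `|c|.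
have c0 : 0 <= `|c| by [].
have a' := coneD hC h (coneC hC c0 a); have b' := coneD hC h (coneC hC c0 b).
rewrite scalerBr addrA subrK in a'; rewrite scalerDr addrA subrK in b'.
have [c1|c1] := leP 0 c; first by rewrite ger0_norm // in a' b'.
rewrite ltr0_norm // polyCN scaleNr in a' b'; rewrite opprK in a'.
by split.
Qed.

Lemma germ_hullZ g m : germ_hull m -> germ_hull (g *: m).
Proof.
move=> hm; elim/poly_ind: g => [|g c IH].
  by rewrite -polyC0; exact: germ_hullC.
rewrite scalerDl mulrC -scalerA; apply: germ_hullD; last exact: germ_hullC.
by case: XS => h; [rewrite -h germ_hull_S | rewrite -germ_hull_S h].
Qed.

Lemma germ_hull_le m n : C m -> C (n - m) -> germ_hull n -> germ_hull m.
Proof.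
move=> Cm Cmn [k [a b]]; exists k; split; first exact: (cone_trans hC Cmn a).
by apply: (coneD hC) => //; exact/CiterS.
Qed.

(** Infinite growth passes from x to every element m of the hull that is not
    negligible: x lies below an iterate of m and m below an iterate of x, so a
    real bound on the growth of m would bound an iterate of x by a real multiple
    of the preceding one. *)
Lemma germ_growth m c : germ_hull m -> strictly germ_cone m ->
  C (S m - c%:P *: m).
Proof.
move=> [l [a _]] sm; have [k nk] : exists k, ~ C (iter k S (- m) + x).
  exact/existsNP.
have Cm : C m by have [//|/germ_coneW/sm] := cone_total hC m.
have {nk} xm : C (iter k S m - x).
  by have [//|] := cone_total hC (iter k S (- m) + x); rewrite opprD iterSN opprK.
wlog c1 : c / 1 <= c.
  move=> H; have [/H//|/ltW c1] := leP 1 c.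
  have h := coneD hC (H 1 (lexx _)) (cone_le hC Cm c1); lmod_exact h.
have [//|h] := cone_total hC (S m - c%:P *: m); case: not_CNx.
rewrite opprB in h.
have hi i : C ((c ^+ i)%:P *: m - iter i S m).
  elim: i => [|i IH]; first by rewrite expr0 polyC1 scale1r subrr; exact: (cone0 hC).
  apply: (cone_trans hC (y := c%:P *: iter i S m)).
    by rewrite iterSr -iterSC -iterSN -iterSD; exact/CiterS.
  rewrite exprS polyCM -scalerA -scalerBr; apply: (coneC hC) => //.
  exact: le_trans c1.
have := hi (l.+1 + k)%N; set e := c ^+ _ => {}hi.
have e0 : 0 <= e by rewrite exprn_ge0 // (le_trans _ c1).
have h1 : C (e%:P *: iter l S x - e%:P *: m) by rewrite -scalerBr; exact: (coneC hC).
have h2 : C (iter (l.+1 + k) S m - iter l.+1 S x).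
  by rewrite iterD -iterSN -iterSD; exact/CiterS.
have := cone_trans hC h2 (cone_trans hC hi h1).
rewrite iterSr -iterSC -iterSN -iterSD CiterS => h3.
have {}h3 := coneD hC h3 (Sx (e + 1)); lmod_exact h3.
Qed.

End Germ.

Section GermLevels.
Variables (R : realType) (V : lmodType {poly R}).
Implicit Types (C : V -> Prop) (m n x : V) (c : R) (g p : {poly R}).

(** Growth at all elements of the hull turns the positivity of g m, up to a
    positive multiple of an iterate of m, into the sign rules of a level. *)
Lemma germ_level C x (S : V -> V) (s : {poly R} -> R) :
  total_cone C -> strictly C x ->
  (forall m n, S (m + n) = S m + S n) ->
  (forall (c : R) m, S (c%:P *: m) = c%:P *: S m) ->
  (forall m, C (S m) <-> C m) ->
  (forall c : R, C (S x - c%:P *: x)) ->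
  (forall m, S m = 'X *: m) \/ (forall m, S ('X *: m) = m) ->
  (forall l : seq {poly R}, exists2 t : R, 0 < t &
    forall g, g \in l -> Num.sg g.[t] = Num.sg (s g)) ->
  (forall g, s g = 0 -> g = 0) ->
  (forall g m, 0 < s g -> C m -> (forall c, C (S m - c%:P *: m)) ->
     exists d, exists2 k, 0 < d & C (g *: m - d%:P *: ('X^k *: m))) ->
  level C x.
Proof.
move=> hC sx SD SC CS Sx XS sreal s0 act.
have hL := germ_cone_total hC sx SD SC CS Sx XS.
pose L := germ_cone C x S.
have LW m : C m -> L m by exact: germ_coneW.
have CL m : strictly L m -> C m.
  by move=> sm; have [//|/LW/sm] := cone_total hC m.
have act' g m : 0 < s g -> germ_hull C x S m -> strictly L m ->
    exists d, exists2 k, 0 < d & L (g *: m - d%:P *: ('X^k *: m)).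
  move=> g0 Hm sm; have [|d [k d0 h]] := act g m g0 (CL _ sm).
    by move=> c; exact: (germ_growth hC sx SD SC CS Sx).
  by exists d, k => //; exact: LW.
exists s (germ_hull C x S) L => //.
- exists 0%N => /=; rewrite subrr; split; first exact: (cone0 hC).
  by apply: (coneD hC); exact: (strictlyW hC sx).
- exact: (germ_hullD hC SD SC CS Sx).
- exact: (germ_hullZ hC SD SC CS Sx XS).
- move=> m; case: XS => h; first by rewrite -h (germ_hull_S hC SD SC CS Sx).
  by rewrite -(germ_hull_S hC SD SC CS Sx) h.
- exact: (germ_hull_le hC sx CS).
- exact: (germ_cone_base hC sx SC Sx).
- move=> g m; rewrite le_eqVlt => /predU1P[/esym/s0 ->|g0] Hm Lm.
    by rewrite scale0r; exact: (cone0 hL).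
  have [Nm|sm] := pselect (L (- m)); first exact: (cone_null _ hL).
  have [d [k d0 h]] := act' g m g0 Hm sm.
  have {}h := coneD hL h (coneC hL (ltW d0) ((coneXn k m hL).2 Lm)); lmod_exact h.
move=> g m g0 Hm Lgm; have [//|nm] := pselect (L m).
have HN : germ_hull C x S (- m).
  by rewrite -[- m]scaleN1r; exact: (germ_hullZ hC SD SC CS Sx XS).
have sN : strictly L (- m) by rewrite /strictly opprK.
have [d [k d0 h]] := act' g _ g0 HN sN.
apply/(coneXn k m hL)/(coneCV hL d0).
have {}h := coneD hL h Lgm; lmod_exact h.
Qed.

Lemma lead_coef_MXaddC p c :
  lead_coef (p * 'X + c%:P) = if p == 0 then c else lead_coef p.
Proof.
have [->|p0] := eqVneq p 0; first by rewrite mul0r add0r lead_coefC.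
rewrite !lead_coefE size_MXaddC (negPf p0) /= coefD coefMX coefC.
have /prednK sz : (0 < size p)%N by rewrite size_poly_gt0.
by rewrite -sz /= addr0.
Qed.

(** In Horner form, a coefficient added to a multiple of 'X is absorbed by 'X m,
    which exceeds every real multiple of m. *)
Lemma lead_coef_act C g m : total_cone C -> 0 < lead_coef g -> C m ->
  (forall c, C ('X *: m - c%:P *: m)) ->
  exists2 d, 0 < d & C (g *: m - d%:P *: m).
Proof.
move=> hC + Cm Xm; elim/poly_ind: g => [|p c IH]; first by rewrite lead_coef0 ltxx.
rewrite lead_coef_MXaddC; have [->|p0] := eqVneq p 0 => l0.
  by exists c => //; rewrite mul0r add0r subrr; exact: (cone0 hC).
have [d d0 h] := IH l0; exists 1 => //.
have h1 := (coneX hC _).2 h; have h2 := coneC hC (ltW d0) (Xm ((1 - c) / d)).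
have e : d * ((1 - c) / d) = 1 - c by rewrite mulrC divfK // gt_eqF.
rewrite scalerBr [_ *: (_%:P *: m)]scalerA -polyCM e in h2.
have {}h := coneD hC h1 h2; lmod_exact h.
Qed.

Lemma sg_horner_pinfty (l : seq {poly R}) : exists2 t : R, 0 < t &
  forall u, t <= u -> forall g, g \in l -> Num.sg g.[u] = Num.sg (lead_coef g).
Proof.
elim: l => [|g l [t t0 IH]]; first by exists 1.
exists (Num.max t (cauchy_bound g)); first by rewrite lt_max t0.
move=> u; rewrite ge_max => /andP[tu bu] h; rewrite inE => /predU1P[->|]; last exact: IH.
have [->|g0] := eqVneq g 0; first by rewrite horner0 lead_coef0.
rewrite (sgp_pinftyP (ge_cauchy_bound g0)) // in_itv /=.
by rewrite bu.
Qed.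

Lemma pinfty_level C x : total_cone C -> strictly C x ->
  (forall c, C ('X *: x - c%:P *: x)) -> level C x.
Proof.
move=> hC sx Xx; apply: (germ_level (S := fun m => 'X *: m) (s := lead_coef)) => //.
- by move=> m n; rewrite scalerDr.
- by move=> c m; rewrite scaler_comm.
- by move=> m; exact: (coneX hC).
- by left.
- move=> l; have [t t0 h] := sg_horner_pinfty l.
  by exists t => //; exact: h.
- by move=> g /eqP; rewrite lead_coef_eq0 => /eqP.
- move=> g m g0 Cm Xm; have [d d0 h] := lead_coef_act hC g0 Cm Xm.
  by exists d, 0%N => //; rewrite expr0 scale1r.
Qed.

(** Its sign is that of g on a right neighbourhood of 0. *)
Definition low_coef g : R := g`_(find (fun c => c != 0) g).

Lemma low_coef_MXaddC p c :
  low_coef (p * 'X + c%:P) = if c == 0 then low_coef p else c.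
Proof.
have [->|c0] := eqVneq c 0.
  rewrite addr0; have [->|p0] := eqVneq p 0; first by rewrite mul0r.
  by rewrite /low_coef polyseqMX //= eqxx /=.
rewrite /low_coef -cons_poly_def polyseq_cons.
by case: ifP => _; rewrite ?polyseqC /= c0 //= c0.
Qed.

Lemma low_coef0 : low_coef 0 = 0. Proof. by rewrite /low_coef coef0. Qed.

Lemma low_coef_eq0 g : low_coef g = 0 -> g = 0.
Proof.
elim/poly_ind: g => // p c IH; rewrite low_coef_MXaddC.
have [->|c0] := eqVneq c 0; first by move=> /IH ->; rewrite mul0r add0r.
by move=> e; rewrite e eqxx in c0.
Qed.

Lemma sg_horner_zero (l : seq {poly R}) : exists2 t : R, 0 < t &
  forall u, 0 < u <= t -> forall g, g \in l -> Num.sg g.[u] = Num.sg (low_coef g).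
Proof.
elim: l => [|g l [t t0 IH]]; first by exists 1.
suff [v v0 h] : exists2 v, 0 < v &
    forall u, 0 < u <= v -> Num.sg g.[u] = Num.sg (low_coef g).
  exists (Num.min t v); first by rewrite lt_min t0.
  move=> u /andP[u0]; rewrite le_min => /andP[ut uv] k; rewrite inE => /predU1P[->|].
    by apply: h; rewrite u0.
  by apply: IH; rewrite u0.
elim/poly_ind: g => [|p c [v v0 h]]; first by exists 1 => // u; rewrite horner0 low_coef0.
rewrite low_coef_MXaddC; have [->|c0] := eqVneq c 0.
  exists v => // u uv; rewrite addr0 hornerMX sgrM h //.
  by case/andP: uv => u0 _; rewrite [Num.sg u]gtr0_sg // mulr1.
(* near 0 the constant term dominates *)
pose K := \sum_(i < size p) `|p`_i|.
have K0 : 0 <= K by apply: sumr_ge0.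
have bd u : 0 < u <= 1 -> `|p.[u]| <= K.
  move=> /andP[u0 u1]; rewrite horner_coef (le_trans (ler_norm_sum _ _ _)) //.
  apply: ler_sum => i _; rewrite normrM ler_piMr // ger0_norm ?exprn_ge0 ?exprn_ile1 // ltW //.
have d0 : 0 < `|c| / (K + 1) by rewrite divr_gt0 ?normr_gt0 // ltr_wpDl.
exists (Num.min 1 (`|c| / (K + 1))); first by rewrite lt_min ltr01.
move=> u /andP[u0]; rewrite le_min => /andP[u1 uc].
have lt : `|p.[u] * u| < `|c|.
  rewrite normrM (gtr0_norm u0); apply: (@le_lt_trans _ _ (K * u)).
    by apply: ler_wpM2r; [exact: ltW | apply: bd; rewrite u0].
  apply: (@lt_le_trans _ _ ((K + 1) * u)); first by rewrite ltr_pM2r // ltrDl.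
  by rewrite mulrC -ler_pdivlMr // ltr_wpDl.
rewrite hornerD hornerMX hornerC.
move: lt; rewrite ltr_norml; case: (ltrgt0P c) c0 => // c0 _ /andP[l1 l2].
  by rewrite !gtr0_sg // -ltrBlDr sub0r.
by rewrite !ltr0_sg // -ltrBrDr sub0r.
Qed.

(** The iterates of m under 'X decrease, so the absolute values of the coefficients
    of p add up to a bound K. *)
Lemma contracting_bound C p m : total_cone C -> C m -> C (m - 'X *: m) ->
  exists2 K, 0 <= K & C (p *: m + K%:P *: m).
Proof.
move=> hC; elim/poly_ind: p m => [|p c IH] m Cm mX.
  by exists 0 => //; rewrite !scale0r addr0; exact: (cone0 hC).
have [||K K0 h] := IH ('X *: m); [exact/(coneX hC)|by rewrite -scalerBr (coneX hC)|].
exists (K + `|c|); first exact: addr_ge0.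
have h1 : C ((c + `|c|)%:P *: m).
  by apply: (coneC hC) => //; rewrite addrC -lerBlDr sub0r -normrN ler_norm.
have {}h := coneD hC (coneD hC h (coneC hC K0 mX)) h1; lmod_exact h.
Qed.

(** The lowest coefficient dominates, since m exceeds every real multiple of 'X m. *)
Lemma low_coef_act C (S : V -> V) g m : total_cone C ->
  (forall m, C (S m) <-> C m) -> (forall m, S ('X *: m) = m) ->
  (forall m n, S (m + n) = S m + S n) ->
  (forall (c : R) m, S (c%:P *: m) = c%:P *: S m) ->
  0 < low_coef g -> C m -> (forall c, C (S m - c%:P *: m)) ->
  exists d, exists2 k, 0 < d & C (g *: m - d%:P *: ('X^k *: m)).
Proof.
move=> hC CS SX SD SC; elim/poly_ind: g m => [|p c IH] m; first by rewrite low_coef0 ltxx.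
rewrite low_coef_MXaddC => l0 Cm Sm.
have Xm c' : C (m - c'%:P *: ('X *: m)).
  apply/CS; rewrite -scaleNr -polyCN SD SC SX; have h := Sm c'; lmod_exact h.
move: l0; have [->|c0] := eqVneq c 0.
  move=> l0; have [||d [k d0 h]] := IH ('X *: m) l0.
  - exact/(coneX hC).
  - by move=> c'; rewrite SX.
  exists d, k.+1 => //; rewrite exprSr polyC0; lmod_exact h.
move=> {}c0; have c2 : 0 < c / 2 by rewrite divr_gt0.
exists (c / 2), 0%N => //.
have X1 : C ('X *: m - 'X *: ('X *: m)).
  rewrite -scalerBr (coneX hC); have h := Xm 1; lmod_exact h.
have [K K0 h] := contracting_bound p hC ((coneX hC _).2 Cm) X1.
have h1 := coneC hC (ltW c2) (Xm (K / (c / 2))).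
have e : (c / 2) * (K / (c / 2)) = K by rewrite mulrC divfK // gt_eqF.
rewrite scalerBr [_ *: (_%:P *: ('X *: m))]scalerA -polyCM e in h1.
have h2 := coneD hC h h1; rewrite expr0.
have e2 : c = c / 2 + c / 2 by exact: splitr.
by rewrite {1}e2; lmod_exact h2.
Qed.

Lemma zero_level C x (S : V -> V) : total_cone C -> strictly C x ->
  (forall m, S ('X *: m) = m) -> (forall m, 'X *: S m = m) ->
  (forall c, 0 < c -> C (c%:P *: x - 'X *: x)) -> level C x.
Proof.
move=> hC sx SX XS Xx; have Cx := strictlyW hC sx.
have SD m n : S (m + n) = S m + S n by rewrite -{1}[m]XS -{1}[n]XS -scalerDr SX.
have SC (c : R) m : S (c%:P *: m) = c%:P *: S m.
  by rewrite -{1}[m]XS scaler_comm SX.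
have CS m : C (S m) <-> C m by rewrite -{2}[m]XS (coneX hC).
apply: (germ_level (S := S) (s := low_coef)) => //.
- move=> c; apply/(coneX hC); rewrite scalerBr XS scaler_comm.
  have [c0|c0] := leP c 0.
    have h : C ((- c)%:P *: ('X *: x)).
      by apply: (coneC hC); [rewrite oppr_ge0 | exact/(coneX hC)].
    have {}h := coneD hC Cx h; lmod_exact h.
  have ci : 0 < c^-1 by rewrite invr_gt0.
  have := coneC hC (ltW c0) (Xx _ ci).
  rewrite scalerBr [_ *: (_^-1%:P *: _)]scalerA -polyCM divff ?gt_eqF //.
  by rewrite polyC1 scale1r.
- by right.
- move=> l; have [t t0 h] := sg_horner_zero l.
  by exists t => // g gl; rewrite (h t) ?t0 /=.
- exact: low_coef_eq0.
- by move=> g m; exact: (low_coef_act hC CS SX SD SC).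
Qed.

(** If 'X x is neither infinitely large nor infinitely small with respect to x, then
    it has a standard part tau x, and 'X acts as tau at this level. *)
Theorem level_exists C x (S : V -> V) : total_cone C ->
  (forall m, S ('X *: m) = m) -> (forall m, 'X *: S m = m) ->
  strictly C x -> inhabited (level C x).
Proof.
move=> hC SX XS sx; have Cx := strictlyW hC sx.
have [|/existsNP[c nc]] := pselect (forall c, C ('X *: x - c%:P *: x)).
  by move=> h; constructor; exact: pinfty_level.
have [|/existsNP[d /not_implyP[d0 nd]]] :=
    pselect (forall c, 0 < c -> C (c%:P *: x - 'X *: x)).
  by move=> h; constructor; exact: (zero_level (S := S)).
have cX : C (c%:P *: x - 'X *: x).
  by have [//|] := cone_total hC ('X *: x - c%:P *: x); rewrite opprB.
have dX : C ('X *: x - d%:P *: x).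
  by have [//|] := cone_total hC (d%:P *: x - 'X *: x); rewrite opprB.
have CX : C ('X *: x) by exact/(coneX hC).
have bX : bounded_by C x c ('X *: x).
  split=> //; apply: (coneD hC) => //; apply: (coneC hC) => //.
  have h : C (c%:P *: x - 0%:P *: x).
    rewrite polyC0 scale0r subr0; have h := coneD hC cX CX; lmod_exact h.
  exact: (strictly_mono hC sx h).
have [t ht] := bounded_standard_part hC sx bX.
have t0 : 0 < t.
  apply: (@lt_le_trans _ _ (d / 2)); first by rewrite divr_gt0.
  have d2 : 0 < d / 2 by rewrite divr_gt0.
  have [h _] := ht _ d2; apply: (strictly_mono hC sx).
  have {}h := coneD hC h dX; have e : d = d / 2 + d / 2 by exact: splitr.
  by rewrite {2}e in h; lmod_exact h.
by constructor; exact: (at_level hC sx t0 ht).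
Qed.

End GermLevels.

(** * Elimination *)
Section Elimination.
Variables (R : realType) (V : lmodType {poly R}).
Variables (C : V -> Prop) (hC : total_cone C).
Variable S : V -> V.
Hypothesis SX : forall m, S ('X *: m) = m.
Hypothesis XS : forall m, 'X *: S m = m.
Implicit Types (x y m c : V) (g : {poly R}).

Section LevelSign.
Variables (x : V) (L : level C x).

Lemma sg_posp g : posp g -> 0 < sg L g.
Proof.
move=> g0; have [t t0 /(_ g (mem_head _ _))] := sg_real L [:: g].
by rewrite (gtr0_sg (g0 t t0)) => /esym/eqP; rewrite sgr_cp0.
Qed.

Lemma sg_nnp g : nnp g -> 0 <= sg L g.
Proof.
case=> [->|/sg_posp/ltW//]; have [t t0 /(_ 0 (mem_head _ _))] := sg_real L [:: 0].
by rewrite horner0 sgr0 => /esym/eqP; rewrite sgr_eq0 => /eqP ->.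
Qed.

Lemma sg_oppr g : (0 < sg L (- g)) = (sg L g < 0).
Proof.
have [t t0 h] := sg_real L [:: g; - g].
have h1 := h g (mem_head _ _); have h2 : Num.sg (- g).[t] = Num.sg (sg L (- g)).
  by apply: h; rewrite !inE eqxx orbT.
by rewrite -!sgr_cp0 -h1 -h2 hornerN sgrN -[RHS]eqr_oppLR.
Qed.

Lemma sg_oppr_ge0 g : (0 <= sg L (- g)) = (sg L g <= 0).
Proof. by rewrite -[g in RHS]opprK leNgt [RHS]leNgt sg_oppr. Qed.

End LevelSign.

(** At the level of x, the polynomial g has the sign of one of its values at a
    positive real number. *)
Lemma posp_strictly g x : posp g -> strictly C x -> strictly C (g *: x).
Proof.
move=> g0 sx; have [L] := level_exists hC SX XS sx.
rewrite /strictly -scalerN => /(lconeW L) h; have := lcone_base L; apply.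
apply: (lconeZV (sg_posp L g0)) h.
by rewrite -[- x]scaleN1r; apply: hullZ; exact: hull_base.
Qed.

Lemma nnpZ g x : nnp g -> C x -> C (g *: x).
Proof.
case=> [->|g0] Cx; first by rewrite scale0r; exact: (cone0 hC).
have [CNx|sx] := pselect (C (- x)); first exact: (cone_null _ hC).
exact/(strictlyW hC)/posp_strictly.
Qed.

Lemma not_strictly0 : ~ strictly C 0.
Proof. by rewrite /strictly oppr0 => h; apply: h; exact: (cone0 hC). Qed.

Lemma strictlyZ_inv g x : nnp g -> strictly C (g *: x) -> strictly C x.
Proof. by move=> g0 sx Nx; apply: sx; rewrite -scalerN; exact: nnpZ. Qed.

Variable I : finType.
Implicit Types (G F J : {set I}) (r w s t p : I -> {poly R})
  (q : I -> I -> {poly R}) (a b d : I -> V) (i j k : I).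

(** Gaussian elimination.  The pivot u = r l - q l l satisfies
    u p l = sum q l i p i + w l, and p l > 0 on the half-line, so u is positive there or
    zero; it is not zero, since then the last equation of row l would read
    0 = a l.  Multiplying the other rows by u and adding a multiple of row l
    keeps all coefficients nonnegative on the half-line.  When w vanishes, the last
    pivot would be zero; this is the second conclusion. *)
Lemma elimination G r q w p d a :
  (forall j, j \in G -> posp (p j)) ->
  (forall j i, j \in G -> i \in G -> nnp (q j i)) ->
  (forall j, j \in G -> nnp (w j)) ->
  (forall j, j \in G -> strictly C (a j)) ->
  (forall j, j \in G -> r j * p j = \sum_(i in G) q j i * p i + w j) ->
  (forall j, j \in G -> r j *: d j = a j + \sum_(i in G) q j i *: d i) ->
  (forall j, j \in G -> strictly C (d j)) /\
  (G != finset.set0 -> exists2 j, j \in G & w j != 0).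
Proof.
move: {2}#|G| (erefl #|G|) => n.
elim: n G r q w a => [|n IH] G r q w a Gn p0 q0 w0 a0 ep ed.
  have G0 : G = finset.set0 by apply/eqP; rewrite -cards_eq0 Gn.
  by rewrite G0 eqxx; split=> // j; rewrite inE.
have [l lG] : exists l, l \in G by apply/card_gt0P; rewrite Gn.
pose u : {poly R} := r l - q l l; pose G' := G :\ l.
have G'G j : j \in G' -> j \in G by rewrite !inE => /andP[].
have lp : u * p l = \sum_(i in G') q l i * p i + w l.
  rewrite /u mulrBl ep // (big_setD1 l) //= -/G'.
  by rewrite -[q l l * p l + _ + _]addrA addrAC subrr add0r.
have ld : u *: d l = a l + \sum_(i in G') q l i *: d i.
  by rewrite /u scalerBl ed // (big_setD1 l) //= -/G'; lmod_eq.
have u0 : posp u.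
  have nn i : i \in G' -> nnp (q l i * p i).
    by move=> /G'G iG; apply: nnpM; [exact: q0 | right; exact: p0].
  have nw : nnp (\sum_(i in G') q l i * p i + w l).
    by apply: nnpD; [exact: nnp_sum | exact: w0].
  have [uz|uz] := eqVneq u 0.
    case: not_strictly0; have := a0 l lG; suff -> : a l = 0 by [].
    move: lp ld; rewrite uz mul0r scale0r => /esym e.
    have [e1 _] := nnpD_eq0 (nnp_sum nn) (w0 _ lG) e.
    rewrite big1 ?addr0 // => i iG'; have := nnp_sum_eq0 nn e1 iG'.
    move/eqP; rewrite mulf_eq0 (negPf (posp_neq0 (p0 _ (G'G _ iG')))) orbF => /eqP ->.
    by rewrite scale0r.
  have : posp (u * p l).
    rewrite lp; apply: (nnp_posp nw); rewrite -lp mulf_neq0 //.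
    exact/posp_neq0/p0.
  by move=> up t t0; have := up t t0; rewrite hornerM pmulr_lgt0 // p0.
have [|||||||dG' wG'] := IH G' (fun j => u * r j)
    (fun j i => u * q j i + q j l * q l i) (fun j => u * w j + q j l * w l)
    (fun j => u *: a j + q j l *: a l).
- by apply: succn_inj; rewrite -Gn (cardsD1 l G) lG.
- by move=> j /G'G; exact: p0.
- move=> j i /G'G jG /G'G iG.
  by apply: nnpD; apply: nnpM; try exact: q0; right.
- by move=> j /G'G jG; apply: nnpD; apply: nnpM; try exact: q0; try exact: w0; right.
- move=> j /G'G jG; apply: (strictlyD hC); first by apply: posp_strictly => //; exact: a0.
  by apply: nnpZ; [exact: q0 | apply: (strictlyW hC); exact: a0].
- move=> j jG'; have jG := G'G _ jG'.
  rewrite -mulrA ep // (big_setD1 l) //=.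
  under [in RHS]eq_bigr do rewrite mulrDl -!mulrA.
  rewrite big_split /= -!mulr_sumr.
  have -> : \sum_(i in G') q l i * p i = u * p l - w l by rewrite lp addrK.
  have ring_id (b c e f h k z : {poly R}) :
    b * (c * e + z + f) = b * z + c * (b * e - k) + (b * f + c * k) by ring.
  exact: ring_id.
- move=> j jG'; have jG := G'G _ jG'.
  rewrite -scalerA ed // (big_setD1 l) //=.
  under [in RHS]eq_bigr do rewrite scalerDl -!scalerA.
  rewrite big_split /= -!scaler_sumr.
  have -> : \sum_(i in G') q l i *: d i = u *: d l - a l by rewrite ld addrAC subrr add0r.
  by rewrite -/G'; lmod_eq.
split=> [j jG|_].
  have [->|jl] := eqVneq j l; last by apply: dG'; rewrite !inE jl.
  apply: (@strictlyZ_inv u); first by right.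
  rewrite ld; apply: (strictlyD hC); first exact: a0.
  apply: (cone_sum hC) => i iG'; apply: nnpZ; first by apply: q0 => //; exact: G'G.
  exact/(strictlyW hC)/dG'.
have [G0|/wG'[j jG']] := eqVneq G' finset.set0.
  exists l => //; move: lp; rewrite G0 big_set0 add0r => <-.
  by apply: mulf_neq0; apply: posp_neq0 => //; exact: p0.
have [-> |wj _] := eqVneq (w j) 0; last by exists j => //; exact: G'G.
rewrite mulr0 add0r => wl; exists l => //.
by apply: contraNneq wl => ->; rewrite mulr0.
Qed.

End Elimination.

(** * The maximum principle *)
Lemma exists_max (I : finType) (A : {set I}) (le : I -> I -> Prop) :
  (forall i j, i \in A -> j \in A -> le i j \/ le j i) ->
  (forall j i k, i \in A -> j \in A -> k \in A -> le i j -> le j k -> le i k) ->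
  A != finset.set0 -> exists2 k, k \in A & forall i, i \in A -> le i k.
Proof.
move: {2}#|A| (erefl #|A|) => n; elim: n A => [|n IH] A An tot tr.
  by rewrite -cards_eq0 An.
case/set0Pn => l lA; pose B := A :\ l.
have BA i : i \in B -> i \in A by rewrite !inE => /andP[].
have AB i : i \in A -> i = l \/ i \in B.
  by rewrite !inE; have [->|il] := eqVneq i l; [left | right].
have ll : le l l by case: (tot l l lA lA).
have [B0|Bn] := eqVneq B finset.set0.
  by exists l => // i /AB[->//|]; rewrite B0 inE.
have [||||k kB kmax] := IH B => //.
- by apply: succn_inj; rewrite -An (cardsD1 l A) lA.
- by move=> i j /BA iA /BA jA; exact: tot.
- by move=> j i k /BA iA /BA jA /BA kA; exact: tr.
have [lk|kl] := tot l k lA (BA _ kB).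
  by exists k; [exact: BA | move=> i /AB[->//|]; exact: kmax].
exists l => // i /AB[->//|iB]; apply: (tr k) => //; by [exact: BA | exact: kmax].
Qed.

(** A system r b = a + q b + s c, with slopes r p = q p + s - t, observed at the level
    of x. *)
Section MaxPrinciple.
Variables (R : realType) (V : lmodType {poly R}).
Variables (C : V -> Prop) (hC : total_cone C) (x : V) (L : level C x).
Variable I : finType.
Variables (F : {set I}) (r s t p : I -> {poly R}) (q : I -> I -> {poly R}).
Variables (a b : I -> V) (c : V).
Implicit Types (i j k : I) (m : V) (g : {poly R}).

Notation LC := (lcone L).

Hypothesis q0 : forall j i, j \in F -> i \in F -> nnp (q j i).
Hypothesis s0 : forall j, j \in F -> nnp (s j).
Hypothesis t0 : forall j, j \in F -> nnp (t j).
Hypothesis a0 : forall j, j \in F -> C (a j).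
Hypothesis bH : forall j, j \in F -> hull L (b j).
Hypothesis cH : hull L c.
Hypothesis b0 : forall j, j \in F -> LC (b j).
Hypothesis bn0 : forall j, j \in F -> 0 <= sg L (p j) -> strictly LC (b j).
Hypothesis eb : forall j, j \in F ->
  r j *: b j = a j + \sum_(i in F) q j i *: b i + s j *: c.
Hypothesis ep : forall j, j \in F ->
  r j * p j = \sum_(i in F) q j i * p i + s j - t j.

Let hL : total_cone LC := lcone_total L.

Lemma hullN m : hull L m -> hull L (- m).
Proof. by rewrite -[- m]scaleN1r; exact: hullZ. Qed.

Lemma hullB m m' : hull L m -> hull L m' -> hull L (m - m').
Proof. by move=> h h'; apply: hullD => //; exact: hullN. Qed.

Lemma hull_sum (P : pred I) (f : I -> V) :
  (forall i, P i -> hull L (f i)) -> hull L (\sum_(i | P i) f i).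
Proof.
move=> h; apply: big_ind => //; last exact: hullD.
by rewrite -[0](scale0r x); apply: hullZ; exact: hull_base.
Qed.

Lemma lcone_nnp g m : nnp g -> hull L m -> LC m -> LC (g *: m).
Proof. by move=> g0; apply: lconeZ; exact: sg_nnp. Qed.

Lemma lcone_sum_null (P : pred I) (f : I -> V) :
  (forall i, P i -> LC (f i)) -> LC (- \sum_(i | P i) f i) ->
  forall i, P i -> LC (- f i).
Proof.
move=> f0 + i Pi; rewrite (bigD1 i) //= => h.
have h' : LC (\sum_(j | P j && (j != i)) f j).
  by apply: (cone_sum hL) => j /andP[+ _]; exact: f0.
have {}h := coneD hL h h'; lmod_exact h.
Qed.

(** The indices of positive slope at which p k / b k is largest, that is, where
    b k - p k y vanishes first as y grows from 0. *)
Definition maximizers : {set I} :=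
  [set k in F | (0 < sg L (p k)) &&
    `[< forall i, i \in F -> 0 < sg L (p i) -> LC (p k *: b i - p i *: b k) >]].

Lemma maximizersP k : reflect
  [/\ k \in F, 0 < sg L (p k) &
    forall i, i \in F -> 0 < sg L (p i) -> LC (p k *: b i - p i *: b k)]
  (k \in maximizers).
Proof.
rewrite inE; apply: (iffP and3P) => -[kF kp h]; split=> //; exact/asboolP.
Qed.

Lemma ratio_trans i j k : i \in F -> j \in F -> k \in F ->
  0 < sg L (p i) -> 0 < sg L (p j) -> 0 < sg L (p k) ->
  LC (p j *: b i - p i *: b j) -> LC (p k *: b j - p j *: b k) ->
  LC (p k *: b i - p i *: b k).
Proof.
move=> iF jF kF pi pj pk h1 h2.
have hB l l' (lF : l \in F) (l'F : l' \in F) : hull L (p l *: b l' - p l' *: b l).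
  by apply: hullB; apply: hullZ; exact: bH.
apply: (lconeZV pj); first exact: hB.
have h := coneD hL (lconeZ (ltW pk) (hB _ _ jF iF) h1) (lconeZ (ltW pi) (hB _ _ kF jF) h2).
lmod_exact h.
Qed.

Lemma maximizers_neq0 i : i \in F -> 0 < sg L (p i) -> maximizers != finset.set0.
Proof.
move=> iF ip; pose A := [set k in F | 0 < sg L (p k)].
have AP k : k \in A -> k \in F /\ 0 < sg L (p k) by rewrite inE => /andP.
have [| | |k /AP[kF kp] kmax] :=
    @exists_max I A (fun i k => LC (p k *: b i - p i *: b k)).
- move=> j k _ _; have [|h] := cone_total hL (p k *: b j - p j *: b k); first by left.
  by right; lmod_exact h.
- move=> j k l /AP[kF kp] /AP[jF jp] /AP[lF lp]; exact: ratio_trans.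
- by apply/set0Pn; exists i; rewrite inE iF.
apply/set0Pn; exists k; apply/maximizersP; split=> // j jF jp.
by apply: kmax; rewrite inE jF.
Qed.

(** Eliminating r k between the two equations of row k gives
      p k a k + sum_i q k i (p k b i - p i b k) + s k (p k c - b k) + t k b k = 0.
    At a maximizer all terms are nonnegative, so all of them are negligible. *)
Lemma max_principle k : k \in maximizers ->
  s k = 0 \/ LC (p k *: c - b k) ->
  [/\ t k = 0, s k = 0 \/ LC (b k - p k *: c) &
      forall i, i \in F -> q k i != 0 -> i \in maximizers].
Proof.
move=> /maximizersP[kF kp kmax] sk.
have hB l l' (lF : l \in F) (l'F : l' \in F) : hull L (p l *: b l' - p l' *: b l).
  by apply: hullB; apply: hullZ; exact: bH.
have hC' : hull L (p k *: c - b k) by apply: hullB; [exact: hullZ | exact: bH].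
pose T2 i := q k i *: (p k *: b i - p i *: b k).
have sum0 : p k *: a k + \sum_(i in F) T2 i + s k *: (p k *: c - b k) + t k *: b k = 0.
  have e1 := congr1 (fun m => p k *: m) (eb kF).
  have e2 := congr1 (fun g => g *: b k) (ep kF).
  rewrite /= in e1 e2.
  have -> : \sum_(i in F) T2 i =
      p k *: (\sum_(i in F) q k i *: b i) - (\sum_(i in F) q k i * p i) *: b k.
    rewrite scaler_sumr scaler_suml -sumrB; apply: eq_bigr => i _.
    by rewrite /T2; lmod_eq.
  have e : p k *: (r k *: b k) - (r k * p k) *: b k = 0 by lmod_eq.
  rewrite e1 e2 in e; rewrite -[RHS]e; lmod_eq.
have aH : hull L (a k).
  have -> : a k = r k *: b k - (\sum_(i in F) q k i *: b i) - s k *: c.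
    by rewrite eb //; lmod_eq.
  apply: hullB; last exact: hullZ.
  apply: hullB; first by apply: hullZ; exact: bH.
  by apply: hull_sum => i iF; apply: hullZ; exact: bH.
have h1 : LC (p k *: a k) by apply: lconeZ => //; [exact: ltW | exact/lconeW/a0].
have h2' i : i \in F -> LC (p k *: b i - p i *: b k).
  move=> iF; have [ip|ip] := ltP 0 (sg L (p i)); first exact: kmax.
  apply: (coneD hL); first by apply: lconeZ; [exact: ltW | exact: bH | exact: b0].
  by rewrite -scaleNr; apply: lconeZ; [rewrite sg_oppr_ge0 | exact: bH | exact: b0].
have h2 i : i \in F -> LC (T2 i).
  by move=> iF; apply: lcone_nnp; [exact: q0 | exact: hB | exact: h2'].
have h2s := cone_sum hL h2.
have h3 : LC (s k *: (p k *: c - b k)).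
  case: sk => [->|h]; first by rewrite scale0r; exact: (cone0 hL).
  by apply: lcone_nnp => //; exact: s0.
have h4 : LC (t k *: b k) by apply: lcone_nnp; [exact: t0 | exact: bH | exact: b0].
have bk := bn0 kF (ltW kp).
have n2 : LC (- \sum_(i in F) T2 i).
  have h := coneD hL h1 (coneD hL h3 h4).
  have e : - (\sum_(i in F) T2 i) = p k *: a k + (s k *: (p k *: c - b k) + t k *: b k).
    by apply/esym/eqP; rewrite -subr_eq0 -[X in _ == X]sum0; apply/eqP; lmod_eq.
  by rewrite e.
split.
- apply/eqP/negP => /negP tk; apply: bk.
  have tp := sg_posp L (nnp_posp (t0 kF) tk).
  apply: (lconeZV tp); first exact/hullN/bH.
  have h := coneD hL h1 (coneD hL h3 h2s).
  have e : t k *: - b k = p k *: a k + (s k *: (p k *: c - b k) + \sum_(i in F) T2 i).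
    by apply/esym/eqP; rewrite -subr_eq0 -[X in _ == X]sum0; apply/eqP; lmod_eq.
  by rewrite e.
- have [|sk0] := eqVneq (s k) 0; first by left.
  right; have sp := sg_posp L (nnp_posp (s0 kF) sk0).
  apply: (lconeZV sp); first by rewrite -opprB; exact: hullN.
  have h := coneD hL h1 (coneD hL h4 h2s).
  have e : s k *: (b k - p k *: c) = p k *: a k + (t k *: b k + \sum_(i in F) T2 i).
    by apply/esym/eqP; rewrite -subr_eq0 -[X in _ == X]sum0; apply/eqP; lmod_eq.
  by rewrite e.
move=> i iF qi.
have qp := sg_posp L (nnp_posp (q0 kF iF) qi).
have ni : LC (p i *: b k - p k *: b i).
  apply: (lconeZV qp); first exact: hB.
  have h := lcone_sum_null h2 n2 iF; rewrite /T2 in h; lmod_exact h.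
have ip : 0 < sg L (p i).
  rewrite ltNge; apply/negP => ip; rewrite le_eqVlt in ip.
  case/predU1P: ip => [ip|ip].
    apply: (bn0 iF); first by rewrite ip.
    apply: (lconeZV kp); first exact/hullN/bH.
    have h' : LC (- p i *: b k).
      by apply: lconeZ; [rewrite sg_oppr_ge0 ip | exact: bH | exact: b0].
    have h := coneD hL ni h'; lmod_exact h.
  apply: bk; apply: (@lconeZV _ _ _ _ L (- p i)); first by rewrite sg_oppr.
    exact/hullN/bH.
  have h' : LC (p k *: b i) by apply: lconeZ; [exact: ltW | exact: bH | exact: b0].
  have h := coneD hL ni h'; lmod_exact h.
apply/maximizersP; split=> // l lF lp.
apply: (ratio_trans lF kF iF lp kp ip) => //; exact: kmax.
Qed.

End MaxPrinciple.

(** * Systems of slopes *)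
Section Closed.
Variables (R : realType) (I : finType).
Implicit Types (G J : {set I}) (q : I -> I -> {poly R}).

Definition closed_in q G J := forall j i, j \in J -> i \in G -> i \notin J -> q j i = 0.

Definition irreducible_on q G :=
  forall J, J \subset G -> J != finset.set0 -> closed_in q G J -> J = G.

Lemma closed_sum (W : nmodType) G J (f : I -> W) : J \subset G ->
  (forall i, i \in G -> i \notin J -> f i = 0) ->
  \sum_(i in G) f i = \sum_(i in J) f i.
Proof.
move=> JG f0; rewrite (big_setID J) /= (finset.setIidPr JG) [X in _ + X]big1 ?addr0 //.
by move=> i; rewrite inE => /andP[iJ iG]; exact: f0.
Qed.

(** The indices from which no chain q j k <> 0 inside G leads to a nonzero u: the
    union of the closed sets on which u vanishes. *)
Definition basin q G (u : I -> {poly R}) : {set I} :=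
  [set j in G | `[< exists J, [/\ J \subset G, closed_in q G J,
     (forall i, i \in J -> u i = 0) & j \in J] >]].

Lemma basin_sub q G u : basin q G u \subset G.
Proof. by apply/fintype.subsetP => j; rewrite inE => /andP[]. Qed.

Lemma basin_max q G u J j : J \subset G -> closed_in q G J ->
  (forall i, i \in J -> u i = 0) -> j \in J -> j \in basin q G u.
Proof.
move=> JG cJ uJ jJ; rewrite inE (fintype.subsetP JG) //=.
by apply/asboolP; exists J.
Qed.

Lemma basin_zero q G u j : j \in basin q G u -> u j = 0.
Proof. by rewrite inE => /andP[_ /asboolP[J [_ _ h jJ]]]; exact: h. Qed.

Lemma basin_closed q G u : closed_in q G (basin q G u).
Proof.
move=> j i + iG iN; rewrite inE => /andP[_ /asboolP[J [JG cJ uJ jJ]]].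
have iJ : i \notin J by apply: contra iN; exact: (basin_max JG cJ uJ).
exact: (cJ j i).
Qed.

End Closed.

Section Polynomials.
Variables (R : realType) (I : finType).
Implicit Types (G J : {set I}) (r w p : I -> {poly R}) (q : I -> I -> {poly R}).

Section Irreducible.
Variables (J : {set I}) (r w p : I -> {poly R}) (q : I -> I -> {poly R}).
Hypothesis q0 : forall j i, j \in J -> i \in J -> nnp (q j i).
Hypothesis w0 : forall j, j \in J -> nnp (w j).
Hypothesis ep : forall j, j \in J -> r j * p j = \sum_(i in J) q j i * p i + w j.
Hypothesis irr : irreducible_on q J.
Hypothesis nc : forall t, 0 < t -> exists2 j, j \in J & (p j).[t] != 0.

(** The indices where p vanishes at t form a closed set. *)
Lemma irreducible_pos_at (t : R) : 0 < t -> (forall j, j \in J -> 0 <= (p j).[t]) ->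
  forall j, j \in J -> 0 < (p j).[t].
Proof.
move=> t0 pt j jJ; rewrite lt_neqAle pt // andbT eq_sym; apply/negP => pj.
pose Z := [set i in J | (p i).[t] == 0].
suff ZJ : Z = J.
  by have [i] := nc t0; rewrite -ZJ inE => /andP[_ ->].
apply: irr; first by apply/fintype.subsetP => i; rewrite inE => /andP[].
  by apply/set0Pn; exists j; rewrite inE jJ.
move=> k i; rewrite !inE => /andP[kJ /eqP pk] iJ; rewrite iJ /= => pi.
have := congr1 (fun g : {poly R} => g.[t]) (ep kJ).
rewrite hornerM pk mulr0 hornerD horner_sum => /esym/eqP.
have qp l : l \in J -> 0 <= (q k l * p l).[t].
  by move=> lJ; rewrite hornerM mulr_ge0 ?pt //; apply: nnp_ge0 => //; exact: q0.
rewrite paddr_eq0; [|exact: sumr_ge0 | by apply: nnp_ge0 => //; exact: w0].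
rewrite psumr_eq0 // => /andP[/allP/(_ i (mem_index_enum _))/implyP/(_ iJ)].
rewrite hornerM mulf_eq0 (negPf pi) orbF => /eqP qz _.
by have [//|h] := q0 kJ iJ; have := h t t0; rewrite qz ltxx.
Qed.

(** At the first point where positivity fails, all p j are still nonnegative,
    hence positive by irreducible_pos_at. *)
Lemma irreducible_posp (t : R) : 0 < t -> (forall j, j \in J -> 0 < (p j).[t]) ->
  forall j, j \in J -> posp (p j).
Proof.
move=> t0 pt j jJ u u0; rewrite ltNge; apply/negP => pu.
(* move from t to u along a segment, up to the first zero of some p i *)
pose y := t%:P + (u - t) *: 'X : {poly R}.
have yE v : y.[v] = t + (u - t) * v by rewrite !hornerE.
pose g i := p i \Po y; have gE i v : (g i).[v] = (p i).[t + (u - t) * v].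
  by rewrite horner_comp yE.
pose h := \prod_(i in J) g i.
have h0 : 0 < h.[0].
  by rewrite horner_prod prodr_gt0 // => i iJ; rewrite gE mulr0 addr0 pt.
have hn : h != 0 by apply/eqP => hz; rewrite hz horner0 ltxx in h0.
have groot i v : i \in J -> root (g i) v -> root h v.
  move=> iJ; rewrite !rootE horner_prod => /eqP gv.
  by rewrite (bigD1 i) //= gv mul0r.
have neg_root i v : i \in J -> 0 < v -> (g i).[v] < 0 -> exists2 z, z \in `]0, v[ & root h z.
  move=> iJ v0 gv; have [|z zv gz] := @poly_ivtoo _ (g i) 0 v (ltW v0).
    by rewrite nmulr_llt0 // gE mulr0 addr0 pt.
  by exists z => //; exact: (groot i).
have [z z01 hz] : exists2 z, 0 < z <= 1 & root h z.
  have : (g j).[1] <= 0 by rewrite gE mulr1 addrC subrK.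
  rewrite le_eqVlt => /predU1P[g1|/(neg_root _ _ jJ ltr01)[z]].
    by exists 1; rewrite ?ltr01 ?lexx //; apply: (groot j) => //; apply/rootP.
  by rewrite in_itv /= => /andP[z0 /ltW z1] hz; exists z; rewrite ?z0.
have [z' [z'z hz' zmin]] : exists z', [/\ 0 < z' <= 1, root h z' &
    forall v, 0 < v < z' -> ~~ root h v].
  have : z \in roots h 0 2.
    rewrite in_roots hz hn andbT /= in_itv /=; case/andP: z01 => -> z1.
    by rewrite (le_lt_trans z1) // ltr1n.
  have := sorted_roots 0 2 h.
  have : forall v, v \in roots h 0 2 = [&& root h v, v \in `]0, 2[ & h != 0].
    by move=> v; rewrite in_roots.
  case: (roots h 0 2) => // z' l lP srt zl.
  have zm v : v \in z' :: l -> z' <= v.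
    rewrite inE => /predU1P[->//|vl]; apply: ltW.
    by move: srt => /= /(order_path_min (@lt_trans _ _))/allP/(_ _ vl).
  have z'z := zm z zl; have := lP z'; rewrite mem_head => /esym/and3P[hz' z'i _].
  exists z'; split=> //.
    by move: z'i; rewrite in_itv /= => /andP[-> _]; rewrite (le_trans z'z) //; case/andP: z01.
  move=> v /andP[v0 vz]; apply/negP => hv; have := lP v; rewrite hv hn in_itv /= v0 /=.
  move: z'i; rewrite in_itv /= => /andP[_ z2]; rewrite (lt_trans vz z2).
  by move=> /zm; rewrite leNgt vz.
have /andP[z'0 z'1] := z'z.
have s0 : 0 < t + (u - t) * z'.
  have -> : t + (u - t) * z' = t * (1 - z') + u * z' by ring.
  by rewrite ltr_wpDl ?mulr_gt0 // mulr_ge0 ?subr_ge0 // ltW.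
have pz i : i \in J -> 0 < (p i).[t + (u - t) * z'].
  apply: irreducible_pos_at => // i' i'J; rewrite -gE leNgt.
  apply/negP => /(neg_root _ _ i'J z'0).
  by case=> v; rewrite in_itv /= => /zmin /negP.
have : 0 < h.[z'] by rewrite horner_prod prodr_gt0 // => i iJ; rewrite gE pz.
by rewrite (rootP hz') ltxx.
Qed.

End Irreducible.

Lemma common_positive_roots G p : (forall j, j \in G -> p j != 0) -> G != finset.set0 ->
  exists h, exists2 p', forall j, j \in G -> p j = h * p' j &
  forall t, 0 < t -> exists2 j, j \in G & (p' j).[t] != 0.
Proof.
move=> p0 /set0Pn[l lG]; have [n] := ubnP (size (p l)).
elim: n p p0 => // n IH p p0 pn.
have [|] := pselect (forall t, 0 < t -> exists2 j, j \in G & (p j).[t] != 0).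
  by exists 1, p => // j _; rewrite mul1r.
move=> /existsNP[t /not_implyP[t0 nt]].
have rt j : j \in G -> root (p j) t.
  by move=> jG; apply/negP => /negP pj; apply: nt; exists j.
pose p1 j := p j %/ ('X - t%:P).
have p1E j : j \in G -> p j = ('X - t%:P) * p1 j.
  by move=> /rt; rewrite -dvdp_XsubCl mulrC => /divpK.
have [||h [p' p'E p'nc]] := IH p1.
- by move=> j jG; apply/eqP => z; have := p0 j jG; rewrite p1E // z mulr0 eqxx.
- rewrite /p1 size_divp ?polyXsubC_eq0 // size_XsubC subn1.
  have /prednK sz : (0 < size (p l))%N by rewrite size_poly_gt0 p0.
  by rewrite sz -ltnS.
exists (('X - t%:P) * h), p' => // j jG.
by rewrite p1E // p'E // mulrA.
Qed.

End Polynomials.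

Section Slopes.
Variables (R : realType) (V : lmodType {poly R}).
Variables (C : V -> Prop) (hC : total_cone C).
Variable S : V -> V.
Hypothesis SX : forall m, S ('X *: m) = m.
Hypothesis XS : forall m, 'X *: S m = m.
Variable I : finType.
Implicit Types (G F J : {set I}) (r w p : I -> {poly R})
  (q : I -> I -> {poly R}) (a b d : I -> V) (i j k : I).

(** All terms of the equation of row j are nonnegative, so they are negligible as
    soon as b j is. *)
Lemma level_null_closed x (L : level C x) J (s : {poly R}) (c : V)
    r q a b j : (forall i, i \in J -> nnp (q j i)) -> nnp s ->
  (forall i, i \in J -> hull L (b i)) -> (forall i, i \in J -> lcone L (b i)) ->
  j \in J ->  C (a j) -> hull L c -> lcone L c ->
  r j *: b j = a j + \sum_(i in J) q j i *: b i + s *: c ->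
  lcone L (- b j) -> (s != 0 -> lcone L (- c)) /\
  (forall i, i \in J -> q j i != 0 -> lcone L (- b i)).
Proof.
move=> q0 s0 bH b0 jJ a0 cH c0 eb nb.
have hL := lcone_total L.
have h0 : lcone L (- (r j *: b j)).
  by rewrite -scaleNr; apply: (cone_null _ hL); [exact: b0 | exact: nb].
have h1 : lcone L (a j) by exact: lconeW.
have qb i : i \in J -> lcone L (q j i *: b i).
  by move=> iJ; apply: lcone_nnp; [exact: q0 | exact: bH | exact: b0].
have h2 := cone_sum hL qb.
have h3 : lcone L (s *: c) by exact: lcone_nnp.
rewrite eb in h0; split=> [sn|].
  apply: (lconeZV (sg_posp L (nnp_posp s0 sn))); first exact: hullN.
  have h := coneD hL h0 (coneD hL h1 h2); lmod_exact h.
move=> i iJ qn; apply: (lconeZV (sg_posp L (nnp_posp (q0 _ iJ) qn))).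
  exact/hullN/bH.
have h2' : lcone L (- \sum_(i in J) q j i *: b i).
  have h := coneD hL h0 (coneD hL h1 h3); lmod_exact h.
by rewrite scalerN; apply: (lcone_sum_null qb h2').
Qed.

(** At the level of the sum of the b j, every b j counts: the indices of the
    negligible ones form a closed set, and not all are negligible.  If some slope
    is negative there, apply the maximum principle to - p, with s = 0 and t = w:
    the maximizers form a closed set, which is all of G.  Otherwise all slopes are
    nonnegative there.  In both cases the sign is found at a positive real number
    and spreads to the half-line. *)
Lemma irreducible_sign G r q w p a b : G != finset.set0 -> irreducible_on q G ->
  (forall j i, j \in G -> i \in G -> nnp (q j i)) ->
  (forall j, j \in G -> nnp (w j)) ->
  (forall j, j \in G -> C (a j)) ->
  (forall j, j \in G -> strictly C (b j)) ->
  (forall j, j \in G -> r j *: b j = a j + \sum_(i in G) q j i *: b i) ->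
  (forall j, j \in G -> r j * p j = \sum_(i in G) q j i * p i + w j) ->
  (forall t, 0 < t -> exists2 j, j \in G & (p j).[t] != 0) ->
  (forall j, j \in G -> posp (p j)) \/
  (forall j, j \in G -> w j = 0 /\ posp (- p j)).
Proof.
move=> Gn irr q0 w0 a0 b0 eb ep nc.
have Cb j : j \in G -> C (b j) by move=> /b0; exact: (strictlyW hC).
pose x := \sum_(j in G) b j.
have Cbx j : j \in G -> C (x - b j).
  move=> jG; rewrite /x (bigD1 j) //= addrAC subrr add0r.
  by apply: (cone_sum hC) => i /andP[/Cb].
have sx : strictly C x.
  have /set0Pn[j jG] := Gn; have := strictlyD hC (b0 j jG) (Cbx j jG).
  by rewrite addrC subrK.
have [L] := level_exists hC SX XS sx; have hL := lcone_total L.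
have bH j : j \in G -> hull L (b j).
  by move=> jG; apply: (hull_le (Cb _ jG) (Cbx _ jG)); exact: hull_base.
have Lb j : j \in G -> lcone L (b j) by move=> /Cb; exact: lconeW.
have sb j : j \in G -> strictly (lcone L) (b j).
  move=> jG nb; pose Z := [set i in G | `[< lcone L (- b i) >]].
  have ZP i : i \in Z -> i \in G /\ lcone L (- b i).
    by rewrite inE => /andP[-> /asboolP].
  suff ZG : Z = G.
    have := lcone_base L; apply; rewrite /x -sumrN.
    by apply: (cone_sum hL) => i; rewrite -{1}ZG => /ZP[].
  apply: irr; first by apply/fintype.subsetP => i /ZP[].
    by apply/set0Pn; exists j; rewrite inE jG; exact/asboolP.
  move=> k i /ZP[kG nk] iG; rewrite inE iG /= => /asboolP ni.
  have eb' : r k *: b k = a k + \sum_(i in G) q k i *: b i + 0 *: x.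
    by rewrite eb // scale0r addr0.
  have [_ h] := level_null_closed (fun i => q0 k i kG) (@nnp0 R) bH Lb kG (a0 k kG)
     (hull_base L) (lconeW L (strictlyW hC sx)) eb' nk.
  by apply/eqP/negP => /negP /(h i iG).
have [[l lG pl]|nneg] := pselect (exists2 l, l \in G & sg L (p l) < 0); last first.
  left; have [t t0 ht] := sg_real L [seq p j | j <- enum G].
  have pt j : j \in G -> 0 <= (p j).[t].
    move=> jG; rewrite -sgr_ge0 ht ?sgr_ge0; last by apply: map_f; rewrite mem_enum.
    by rewrite leNgt; apply/negP => pj; apply: nneg; exists j.
  apply: (irreducible_posp q0 w0 ep irr nc t0).
  exact: (irreducible_pos_at q0 w0 ep irr nc t0).
pose n j := - p j.
have en j : j \in G -> r j * n j = \sum_(i in G) q j i * n i + 0 - w j.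
  move=> jG; rewrite /n mulrN ep // opprD addr0; congr (_ + _).
  by rewrite -sumrN; apply: eq_bigr => i _; rewrite mulrN.
have eb' j : j \in G -> r j *: b j = a j + \sum_(i in G) q j i *: b i + 0 *: x.
  by move=> jG; rewrite eb // scale0r addr0.
have bn0 j : j \in G -> 0 <= sg L (n j) -> strictly (lcone L) (b j).
  by move=> jG _; exact: sb.
have s0 j : j \in G -> nnp (0 : {poly R}) by move=> _; exact: nnp0.
pose M := maximizers L G n b.
have MP k : k \in M -> w k = 0 /\ forall i, i \in G -> q k i != 0 -> i \in M.
  move=> kM; have [//|-> _ h] := max_principle (s := fun=> 0) q0 s0 w0 a0 bH (hull_base L)
     Lb bn0 eb' en kM; first by left.
  by split.
have MG : M = G.
  apply: irr.
  - by apply/fintype.subsetP => k /maximizersP[].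
  - apply: (maximizers_neq0 bH lG).
    by rewrite /n sg_oppr.
  move=> k i /MP[_ h] iG; apply: contraNeq; exact: h.
have w00 j : j \in G -> w j = 0 by rewrite -{1}MG => /MP[].
right=> j jG; split; first exact: w00.
have [t t0 ht] := sg_real L [seq n j | j <- enum G].
have nt i : i \in G -> 0 < (n i).[t].
  move=> iG; rewrite -sgr_gt0 ht ?sgr_gt0; last by apply: map_f; rewrite mem_enum.
  by move: iG; rewrite -{1}MG => /maximizersP[].
have en' i : i \in G -> r i * n i = \sum_(k in G) q i k * n k + w i.
  by move=> iG; rewrite en // w00 // subr0.
apply: (irreducible_posp q0 w0 en' irr _ t0 nt) => // u u0.
by have [i iG pi] := nc u u0; exists i => //; rewrite hornerN oppr_eq0.
Qed.

(** Splitting off a proper closed subset, whose slopes move into the constant terms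
    of the other rows, reduces to irreducible systems. *)
Lemma slopes_posp G r q w p a b :
  (forall j i, j \in G -> i \in G -> nnp (q j i)) ->
  (forall j, j \in G -> nnp (w j)) ->
  (forall j, j \in G -> p j != 0) ->
  (forall j, j \in G -> strictly C (a j)) ->
  (forall j, j \in G -> strictly C (b j)) ->
  (forall j, j \in G -> r j *: b j = a j + \sum_(i in G) q j i *: b i) ->
  (forall j, j \in G -> r j * p j = \sum_(i in G) q j i * p i + w j) ->
  forall j, j \in G -> posp (p j).
Proof.
have [n] := ubnP #|G|; elim: n G w a => // n IH G w a Gn q0 w0 p0 a0 b0 eb ep.
have Ca j : j \in G -> C (a j) by move=> /a0; exact: (strictlyW hC).
have Cb j : j \in G -> C (b j) by move=> /b0; exact: (strictlyW hC).
have [[J [JG Jn JnG cJ]]|nred] := pselect (exists J, [/\ J \subset G,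
    J != finset.set0, J != G & closed_in q G J]).
  have Jin j : j \in J -> j \in G by move/fintype.subsetP: JG; apply.
  have Jlt : (#|J| < #|G|)%N by rewrite proper_card // finset.properEneq JnG.
  pose K := G :\: J.
  have Kin j : j \in K -> j \in G by rewrite inE => /andP[].
  have Klt : (#|K| < #|G|)%N.
    rewrite proper_card // finset.properEneq finset.subsetDl andbT; apply/eqP => KG.
    have /set0Pn[j jJ] := Jn; have := Jin j jJ; rewrite -KG inE jJ //.
  have splitG (W : nmodType) (f : I -> W) :
      \sum_(i in G) f i = \sum_(i in J) f i + \sum_(i in K) f i.
    by rewrite (big_setID J) /= (finset.setIidPr JG).
  have pJ : forall j, j \in J -> posp (p j).
    apply: (IH J w a) => //.
    - by rewrite (leq_trans Jlt).
    - by move=> j i /Jin jG /Jin iG; exact: q0.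
    - by move=> j /Jin; exact: w0.
    - by move=> j /Jin; exact: p0.
    - by move=> j /Jin; exact: a0.
    - by move=> j /Jin; exact: b0.
    - move=> j jJ; rewrite eb ?Jin // (closed_sum JG) // => i iG iJ.
      by rewrite cJ ?scale0r.
    - move=> j jJ; rewrite ep ?Jin // (closed_sum JG) // => i iG iJ.
      by rewrite cJ ?mul0r.
  have pK : forall j, j \in K -> posp (p j).
    apply: (IH K (fun j => w j + \sum_(i in J) q j i * p i)
                 (fun j => a j + \sum_(i in J) q j i *: b i)) => //.
    - by rewrite (leq_trans Klt).
    - by move=> j i /Kin jG /Kin iG; exact: q0.
    - move=> j /Kin jG; apply: nnpD; first exact: w0.
      apply: nnp_sum => i iJ; apply: nnpM; first by apply: q0 => //; exact: Jin.
      by right; exact: pJ.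
    - by move=> j /Kin; exact: p0.
    - move=> j /Kin jG; apply: (strictlyD hC); first exact: a0.
      apply: (cone_sum hC) => i /Jin iG; apply: (nnpZ hC SX XS); first exact: q0.
      exact: Cb.
    - by move=> j /Kin; exact: b0.
    - by move=> j /Kin jG; rewrite eb // splitG addrA.
    - by move=> j /Kin jG; rewrite ep // splitG [w j + _]addrC addrA [X in X + w j]addrC.
  move=> j jG; have [/pJ//|jJ] := boolP (j \in J).
  by apply: pK; rewrite inE jJ.
have irr : irreducible_on q G.
  move=> J JG Jn cJ; apply/eqP/negP => /negP JnG; apply: nred; by exists J.
have [->|Gn0] := eqVneq G finset.set0; first by move=> j; rewrite inE.
have [[l lG wl]|w00] := pselect (exists2 l, l \in G & w l != 0).
  have nc (t : R) : 0 < t -> exists2 j, j \in G & (p j).[t] != 0.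
    move=> t0; have wt := nnp_posp (w0 l lG) wl t0.
    have [//|np] := pselect (exists2 j, j \in G & (p j).[t] != 0).
    have pz j : j \in G -> (p j).[t] = 0.
      by move=> jG; apply/eqP/negP => /negP pj; apply: np; exists j.
    have := congr1 (fun g : {poly R} => g.[t]) (ep l lG).
    rewrite hornerM pz // mulr0 hornerD horner_sum big1 ?add0r; last first.
      by move=> i iG; rewrite hornerM pz // mulr0.
    by move=> wz; rewrite -wz ltxx in wt.
  have [//|h] := irreducible_sign Gn0 irr q0 w0 Ca b0 eb ep nc.
  by have [wz _] := h l lG; rewrite wz eqxx in wl.
have {}w00 j : j \in G -> w j = 0.
  by move=> jG; apply/eqP/negP => /negP wj; apply: w00; exists j.
(* only w = 0 is left: then the common positive zeros can be divided out, and
   slopes of one sign contradict elimination, as w has no nonzero entry *)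
have [h [p' p'E nc]] := common_positive_roots p0 Gn0.
have hn : h != 0.
  have /set0Pn[j jG] := Gn0; apply/eqP => hz.
  by have := p0 j jG; rewrite p'E // hz mul0r eqxx.
have z0 j : j \in G -> nnp (0 : {poly R}) by move=> _; exact: nnp0.
have ep' j : j \in G -> r j * p' j = \sum_(i in G) q j i * p' i + 0.
  move=> jG; apply: (mulfI hn); rewrite addr0 mulrCA -p'E // ep // w00 // addr0.
  by rewrite mulr_sumr; apply: eq_bigr => i iG; rewrite mulrCA -p'E.
have absurd (g : I -> {poly R}) : (forall j, j \in G -> posp (g j)) ->
    (forall j, j \in G -> r j * g j = \sum_(i in G) q j i * g i + 0) -> False.
  move=> g0 eg; have [_ /(_ Gn0)[j _]] :=
    elimination (w := fun=> 0) hC SX XS g0 q0 z0 a0 eg eb.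
  by rewrite eqxx.
have [h1|h1] := irreducible_sign Gn0 irr q0 z0 Ca b0 eb ep' nc.
  by case: (absurd p').
case: (absurd (fun j => - p' j)) => [j /h1[]//|j jG].
rewrite mulrN ep' // !addr0 -sumrN; apply: eq_bigr => i _; by rewrite mulrN.
Qed.

End Slopes.

(** * The certificate theorem *)
Section CertificateTheorem.
Variables (R : realType) (V : lmodType {poly R}).
Variables (C : V -> Prop) (hC : total_cone C).
Variable S : V -> V.
Hypothesis SX : forall m, S ('X *: m) = m.
Hypothesis XS : forall m, 'X *: S m = m.
Variables (I : finType) (G : {set I}).
Variables (r s t p : I -> {poly R}) (q : I -> I -> {poly R}).
Variables (a b : I -> V) (c : V).
Implicit Types (i j k : I) (J : {set I}).

Hypothesis q0 : forall j i, j \in G -> i \in G -> nonneg_coef (q j i).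
Hypothesis s0 : forall j, j \in G -> nnp (s j).
Hypothesis t0 : forall j, j \in G -> nnp (t j).
Hypothesis p0 : forall j, j \in G -> p j != 0.
Hypothesis a0 : forall j, j \in G -> strictly C (a j).
Hypothesis b0 : forall j, j \in G -> strictly C (b j).
Hypothesis c0 : strictly C c.
Hypothesis eb : forall j, j \in G ->
  r j *: b j = a j + \sum_(i in G) q j i *: b i + s j *: c.
Hypothesis ep : forall j, j \in G ->
  r j * p j = \sum_(i in G) q j i * p i + s j - t j.

Let qn j i : j \in G -> i \in G -> nnp (q j i).
Proof. by move=> jG iG; apply/nonneg_coef_nnp/q0. Qed.
Let Cc : C c. Proof. exact: (strictlyW hC). Qed.
Let Cb j : j \in G -> C (b j). Proof. by move=> /b0; exact: (strictlyW hC). Qed.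
Let Ca j : j \in G -> C (a j). Proof. by move=> /a0; exact: (strictlyW hC). Qed.

Let NA := basin q G s.
Let NB := basin q G t.

Let closed_sumZ J j (d : I -> V) : J \subset G -> closed_in q G J -> j \in J ->
  \sum_(i in G) q j i *: d i = \sum_(i in J) q j i *: d i.
Proof.
by move=> JG cJ jJ; apply: (closed_sum JG) => i iG iJ; rewrite (cJ j i) // scale0r.
Qed.

Let closed_sumM J j (d : I -> {poly R}) : J \subset G -> closed_in q G J -> j \in J ->
  \sum_(i in G) q j i * d i = \sum_(i in J) q j i * d i.
Proof.
by move=> JG cJ jJ; apply: (closed_sum JG) => i iG iJ; rewrite (cJ j i) // mul0r.
Qed.

(** Without s, the slopes - p obey r (- p) = q (- p) + t. *)
Lemma basin_s_posp j : j \in NA -> posp (- p j).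
Proof.
have sub i : i \in NA -> i \in G by move/fintype.subsetP: (basin_sub q G s); apply.
move: j; apply: (slopes_posp hC SX XS (q := q) (r := r) (w := t) (a := a) (b := b)).
- by move=> j i /sub jG /sub iG; exact: qn.
- by move=> j /sub; exact: t0.
- by move=> j /sub jG; rewrite oppr_eq0 p0.
- by move=> j /sub; exact: a0.
- by move=> j /sub; exact: b0.
- move=> j jN; rewrite eb ?sub // (basin_zero jN) scale0r addr0.
  by rewrite (closed_sumZ _ (basin_sub q G s) (@basin_closed _ _ q G s)).
move=> j jN; rewrite mulrN ep ?sub // (basin_zero jN) addr0.
rewrite (closed_sumM _ (basin_sub q G s) (@basin_closed _ _ q G s)) // opprB addrC.
by congr (_ + _); rewrite -sumrN; apply: eq_bigr => i _; rewrite mulrN.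
Qed.

Lemma basin_s_strictly j : j \in NA -> strictly C (b j - p j *: c).
Proof.
move=> jN; have jG : j \in G by apply: (fintype.subsetP (basin_sub q G s)).
rewrite -scaleNr; apply: (strictlyD hC); first exact: b0.
by apply: (nnpZ hC SX XS) => //; right; exact: basin_s_posp.
Qed.

(** Without t, the values b - p c satisfy r d = a + q d, with positive slopes p. *)
Lemma basin_t_strictly j : j \in NB -> strictly C (b j - p j *: c).
Proof.
have sub i : i \in NB -> i \in G by move/fintype.subsetP: (basin_sub q G t); apply.
have ep' i : i \in NB -> r i * p i = \sum_(k in NB) q i k * p k + s i.
  move=> iN; rewrite ep ?sub // (basin_zero iN) subr0.
  by rewrite (closed_sumM _ (basin_sub q G t) (@basin_closed _ _ q G t)).
have eb' i : i \in NB -> r i *: b i = a i + s i *: c + \sum_(k in NB) q i k *: b k.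
  move=> iN; rewrite eb ?sub // addrAC; congr (_ + _).
  by rewrite (closed_sumZ _ (basin_sub q G t) (@basin_closed _ _ q G t)).
have qn' i k : i \in NB -> k \in NB -> nnp (q i k) by move=> /sub iG /sub; exact: qn.
have sn' i : i \in NB -> nnp (s i) by move=> /sub; exact: s0.
have pp : forall i, i \in NB -> posp (p i).
  apply: (slopes_posp hC SX XS qn' sn' _ _ _ eb' ep').
  - by move=> i /sub; exact: p0.
  - move=> i /sub iG; apply: (strictlyD hC); first exact: a0.
    by apply: (nnpZ hC SX XS) => //; exact: s0.
  - by move=> i /sub; exact: b0.
have aN i : i \in NB -> strictly C (a i) by move=> /sub; exact: a0.
have [|h _] := @elimination _ _ _ hC S SX XS _ NB r q s p (fun i => b i - p i *: c) a
  pp qn' sn' aN ep' _; last exact: h.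
move=> i iN; rewrite scalerBr scalerA ep' // eb' //.
have -> : \sum_(k in NB) q i k *: (b k - p k *: c) =
    \sum_(k in NB) q i k *: b k - (\sum_(k in NB) q i k * p k) *: c.
  by rewrite scaler_suml -sumrB; apply: eq_bigr => k _; rewrite scalerBr scalerA.
lmod_eq.
Qed.

(** One monomial of g m is enough to bound m. *)
Lemma nonneg_coef_hull x (L : level C x) (g : {poly R}) (m : V) : nonneg_coef g -> g != 0 ->
  C m -> hull L (g *: m) -> hull L m.
Proof.
move=> g0 gn Cm h; pose l := (size g).-1.
have gl : 0 < g`_l by rewrite lt_neqAle g0 andbT eq_sym -lead_coefE lead_coef_eq0.
have h1 : hull L ((g`_l)%:P *: ('X^l *: m)).
  apply: hull_le h; first by apply: (coneC hC) => //; exact/(coneXn l m hC).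
  have -> : g *: m - (g`_l)%:P *: ('X^l *: m) = (g - (g`_l)%:P * 'X^l) *: m by lmod_eq.
  apply: (coneZ hC) => // i; rewrite coefB coefCM coefXn.
  by have [->|_] := eqVneq i l; rewrite ?mulr1 ?subrr // mulr0 subr0.
have := hullZ (g`_l)^-1%:P h1; rewrite scalerA -polyCM mulVf ?gt_eqF // polyC1 scale1r.
by elim: (l) => [|n IH]; rewrite ?expr0 ?scale1r // exprS -scalerA => /hullXV.
Qed.

(** For an index j outside both basins with b j - p j c <= 0, look at the level of c
    and at those b k that are not infinite there.  The ratios p k / b k have a
    maximizer, at which b k - p k c <= 0 because this holds at j.  By the maximum
    principle the maximizers form a closed set without t.  If b k - p k c is
    negligible at one of them, then j is itself a maximizer, hence in the basin
    of t.  Otherwise they have no s either, and lie in the basin of s, where slopes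
    are negative. *)
Theorem certificate_strictly j : j \in G -> strictly C (b j - p j *: c).
Proof.
move=> jG; rewrite /strictly opprB => jneg.
have jA : j \notin NA by apply/negP => /basin_s_strictly; rewrite /strictly opprB.
have jB : j \notin NB by apply/negP => /basin_t_strictly; rewrite /strictly opprB.
have [L] := level_exists hC SX XS c0; have hL := lcone_total L.
have cH : hull L c := hull_base L.
have Lc : lcone L c by exact: lconeW.
have Lb i : i \in G -> lcone L (b i) by move=> /Cb; exact: lconeW.
pose F := [set i in G | `[< hull L (b i) >]].
have FP i : i \in F -> i \in G /\ hull L (b i) by rewrite inE => /andP[-> /asboolP].
have FG : F \subset G by apply/fintype.subsetP => i /FP[].
have bH i : i \in F -> hull L (b i) by move=> /FP[].
have cF : closed_in q G F.
  move=> k i /FP[kG kH] iG; rewrite inE iG /= => /asboolP nH.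
  apply/eqP/negP => /negP qki; apply: nH.
  apply: (nonneg_coef_hull (q0 kG iG) qki (Cb iG)).
  apply: (@hull_le _ _ _ _ L _ (r k *: b k)).
  - by apply: (nnpZ hC SX XS); [exact: qn | exact: Cb].
  - rewrite eb // (bigD1 i) //=.
    have h1 : C (\sum_(l in G | l != i) q k l *: b l).
      apply: (cone_sum hC) => l /andP[lG _].
      by apply: (nnpZ hC SX XS); [exact: qn | exact: Cb].
    have h2 : C (s k *: c) by apply: (nnpZ hC SX XS) => //; exact: s0.
    have h := coneD hC (Ca kG) (coneD hC h1 h2); lmod_exact h.
  - exact: hullZ.
have ebF k : k \in F -> r k *: b k = a k + \sum_(i in F) q k i *: b i + s k *: c.
  by move=> kF; have [kG _] := FP k kF; rewrite eb // (closed_sumZ _ FG cF).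
have epF k : k \in F -> r k * p k = \sum_(i in F) q k i * p i + s k - t k.
  by move=> kF; have [kG _] := FP k kF; rewrite ep // (closed_sumM _ FG cF).
have qF k i : k \in F -> i \in F -> nnp (q k i) by move=> /FP[kG _] /FP[iG _]; exact: qn.
have sF k : k \in F -> nnp (s k) by move=> /FP[kG _]; exact: s0.
have tF k : k \in F -> nnp (t k) by move=> /FP[kG _]; exact: t0.
have aF k : k \in F -> C (a k) by move=> /FP[kG _]; exact: Ca.
have LbF k : k \in F -> lcone L (b k) by move=> /FP[kG _]; exact: Lb.
(* negligible values b k form a closed set without s, since c is not negligible *)
have nullNA k : k \in F -> lcone L (- b k) -> k \in NA.
  move=> kF nk; pose F0 := [set i in F | `[< lcone L (- b i) >]].
  have F0P i : i \in F0 -> i \in F /\ lcone L (- b i) by rewrite inE => /andP[-> /asboolP].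
  have nc i : i \in F0 -> s i = 0 /\ forall l, l \in F -> q i l != 0 -> l \in F0.
    move=> /F0P[iF ni].
    have [h1 h2] := level_null_closed (fun l => qF i l iF) (sF i iF) bH LbF iF
      (aF i iF) cH Lc (ebF i iF) ni.
    split=> [|l lF /(h2 l lF) nl]; last by rewrite inE lF; exact/asboolP.
    by apply/eqP/negP => /negP /h1; exact: (lcone_base L).
  apply: (@basin_max _ _ q G s F0).
  - by apply/fintype.subsetP => i /F0P[/FP[]].
  - move=> i l iF0 lG lN; have [iF _] := F0P i iF0.
    have [lF|lF] := boolP (l \in F); last exact: cF iF lG lF.
    by apply: contraNeq lN => /((nc i iF0).2 l lF).
  - by move=> i /nc[].
  - by rewrite inE kF; exact/asboolP.
have sgNA k : k \in NA -> sg L (p k) < 0.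
  by move=> /basin_s_posp h; rewrite -sg_oppr; exact: sg_posp.
have bn0 k : k \in F -> 0 <= sg L (p k) -> strictly (lcone L) (b k).
  by move=> kF pk /(nullNA k kF)/sgNA; rewrite ltNge pk.
have jF : j \in F.
  rewrite inE jG; apply/asboolP; apply: (hull_le (Cb jG) jneg); exact: hullZ.
have Lj : lcone L (p j *: c - b j) by exact: lconeW.
have pj : 0 < sg L (p j).
  rewrite ltNge; apply/negP => pj; move/negP: jA; apply; apply: nullNA => //.
  have h' : lcone L (- p j *: c) by apply: lconeZ => //; rewrite sg_oppr_ge0.
  have h := coneD hL Lj h'; lmod_exact h.
pose M := maximizers L F p b.
have MP k : k \in M -> [/\ k \in F, 0 < sg L (p k) &
    forall i, i \in F -> 0 < sg L (p i) -> lcone L (p k *: b i - p i *: b k)].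
  by move/maximizersP.
have Mc k : k \in M -> lcone L (p k *: c - b k).
  move=> /MP[kF pk kmax]; apply: (lconeZV pj).
    by apply: hullB; [exact: hullZ | exact: bH].
  have h1 : lcone L (p k *: (p j *: c - b j)).
    apply: lconeZ => //; first exact: ltW.
    by apply: hullB; [exact: hullZ | exact: bH].
  have h := coneD hL h1 (kmax j jF pj); lmod_exact h.
have mp k (kM : k \in M) := max_principle qF sF tF aF bH cH LbF bn0 ebF epF kM
  (or_intror (Mc k kM)).
have MG : M \subset G by apply/fintype.subsetP => k /MP[/FP[]].
have cM : closed_in q G M.
  move=> k i kM iG iN; have [kF _ _] := MP k kM; have [_ _ h] := mp k kM.
  have [iF|iF] := boolP (i \in F); last exact: cF kF iG iF.
  by apply: contraNeq iN; exact: h.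
have tM k : k \in M -> t k = 0 by move=> /mp[].
have jM : j \notin M by apply: contra jB; exact: (basin_max MG cM tM).
have nM k : k \in M -> ~ lcone L (b k - p k *: c).
  move=> kM nk; move/negP: jM; apply; have [kF pk kmax] := MP k kM.
  apply/maximizersP; split=> // i iF pi.
  apply: (ratio_trans bH iF kF jF pi pk pj); first exact: kmax.
  have h1 : lcone L (p j *: (b k - p k *: c)).
    apply: lconeZ => //; first exact: ltW.
    by apply: hullB; [exact: bH | exact: hullZ].
  have h2 : lcone L (p k *: (p j *: c - b j)).
    apply: lconeZ => //; first exact: ltW.
    by apply: hullB; [exact: hullZ | exact: bH].
  have h := coneD hL h1 h2; lmod_exact h.
have sM k : k \in M -> s k = 0 by move=> kM; have [_ [//|/(nM k kM)]] := mp k kM.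
have /set0Pn[k kM] := maximizers_neq0 bH jF pj.
have := sgNA k (basin_max MG cM sM kM); have [_ pk _] := MP k kM.
by rewrite ltNge ltW.
Qed.

End CertificateTheorem.

(** * Enlarging cones *)
Section ExtendCone.
Variables (R : realType) (E : lmodType {poly R}).
Implicit Types (x y v : E) (C D : E -> Prop).

(** The power of 'X makes the generated cone invariant under the inverse of 'X. *)
Definition adjoin (I : finType) C (v : I -> E) x :=
  exists n y (q : I -> {poly R}),
    [/\ C y, forall i, nonneg_coef (q i) & 'X^n *: x = y + \sum_i q i *: v i].

Lemma adjoin_cone (I : finType) C (v : I -> E) : cone C -> cone (adjoin C v).
Proof.
move=> hC; split.
- exists 0%N, 0, (fun=> 0); split; [exact: (cone0 hC) | by move=> i; exact: nonneg_coef0 |].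
  by rewrite scaler0 add0r big1 // => i _; rewrite scale0r.
- move=> x x' [n [y [q [Cy q0 e]]]] [n' [y' [q' [Cy' q0' e']]]].
  exists (n + n')%N, ('X^n' *: y + 'X^n *: y'), (fun i => 'X^n' * q i + 'X^n * q' i).
  split.
  + by apply: (coneD hC); exact/(coneXn _ _ hC).
  + by move=> i; apply: nonneg_coefD; apply: nonneg_coefM => //; exact: nonneg_coefXn.
  have -> : 'X^(n + n') *: (x + x') = 'X^n' *: ('X^n *: x) + 'X^n *: ('X^n' *: x').
    by rewrite exprD; lmod_eq.
  under eq_bigr do rewrite scalerDl -!scalerA.
  by rewrite e e' big_split /= -!scaler_sumr; lmod_eq.
- move=> c x c0 [n [y [q [Cy q0 e]]]].
  exists n, (c%:P *: y), (fun i => c%:P * q i); split.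
  + exact: (coneC hC).
  + by move=> i; apply: nonneg_coefM => //; exact: nonneg_coefC.
  under eq_bigr do rewrite -scalerA.
  by rewrite scaler_comm e -scaler_sumr; lmod_eq.
- move=> x; split=> [[n [y [q [Cy q0 e]]]]|[n [y [q [Cy q0 e]]]]].
    by exists n.+1, y, q; split => //; rewrite exprSr -scalerA.
  exists n, ('X *: y), (fun i => 'X * q i); split; first exact/(coneX hC).
    by move=> i; apply: nonneg_coefM => //; exact: nonneg_coefX.
  under eq_bigr do rewrite -scalerA.
  by rewrite scaler_comm e -scaler_sumr; lmod_eq.
Qed.

Lemma adjoin_sub (I : finType) C (v : I -> E) x : C x -> adjoin C v x.
Proof.
move=> Cx; exists 0%N, x, (fun=> 0); split => //; first by move=> i; exact: nonneg_coef0.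
by rewrite scale1r big1 ?addr0 // => i _; rewrite scale0r.
Qed.

Lemma adjoin_gen (I : finType) C (v : I -> E) i : cone C -> adjoin C v (v i).
Proof.
move=> hC; exists 0%N, 0, (fun j => (j == i)%:R); split; first exact: (cone0 hC).
  by move=> j; rewrite -polyC1 -polyCMn; apply: nonneg_coefC; exact: ler0n.
rewrite scale1r add0r (bigD1 i) //= eqxx scale1r big1 ?addr0 // => j /negPf ->.
by rewrite scale0r.
Qed.

(** D stands for the elements that must stay positive.  If adjoining v and adjoining
    - v to a maximal cone both produce an element of - D, then
    - d = y + q v and - d' = y' - q' v up to powers of 'X, and
    - (q' d + q d') = q' y + q y' already lies in the cone. *)
Theorem total_cone_exists C0 D : cone C0 ->
  (forall x y, D x -> D y -> D (x + y)) ->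
  (forall (q : {poly R}) x, nonneg_coef q -> q != 0 -> D x -> D (q *: x)) ->
  (forall x, C0 x -> ~ D (- x)) ->
  exists C, [/\ total_cone C, forall x, C0 x -> C x & forall x, C x -> ~ D (- x)].
Proof.
move=> hC0 DD DZ disj.
have DX n x : D x -> D ('X^n *: x).
  by apply: DZ; [exact: nonneg_coefXn | rewrite -size_poly_eq0 size_polyXn].
pose U (A : set E) x := C0 x \/ A x.
pose good (A : set E) := cone (U A) /\ forall x, U A x -> ~ D (- x).
have [F Fgood Ftot|A [[hA Adisj] Amax]] := @Zorn_bigcup E good.
  have pair x y : U (\bigcup_(X in F) X)%classic x -> U (\bigcup_(X in F) X)%classic y ->
      (C0 x /\ C0 y) \/ exists2 X, F X & U X x /\ U X y.
    move=> [x0|[X FX Xx]] [y0|[Y FY Yy]].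
    - by left.
    - by right; exists Y => //; split; [left | right].
    - by right; exists X => //; split; [right | left].
    right; have [XY|YX] := Ftot X Y FX FY.
      by exists Y => //; split; right => //; exact: XY.
    by exists X => //; split; right => //; exact: YX.
  have up X x : F X -> U X x -> U (\bigcup_(X in F) X)%classic x.
    by move=> FX [x0|Xx]; [left | right; exists X].
  split; last first.
    move=> x Ux; have [[x0 _]|[X FX [Xx _]]] := pair x x Ux Ux; first exact: disj.
    by have [_] := Fgood X FX; apply.
  split.
  - by left; exact: (cone0 hC0).
  - move=> x y Ux Uy; have [[x0 y0]|[X FX [Xx Xy]]] := pair x y Ux Uy.
      by left; exact: (coneD hC0).
    by have [hX _] := Fgood X FX; apply: (up X) => //; exact: (coneD hX).
  - move=> c x c0 Ux; have [[x0 _]|[X FX [Xx _]]] := pair x x Ux Ux.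
      by left; exact: (coneC hC0).
    by have [hX _] := Fgood X FX; apply: (up X) => //; exact: (coneC hX).
  move=> x; split=> Ux; have [[x0 _]|[X FX [Xx _]]] := pair _ _ Ux Ux.
  - by left; apply/(coneX hC0).
  - by have [hX _] := Fgood X FX; apply: (up X) => //; apply/(coneX hX).
  - by left; apply/(coneX hC0).
  by have [hX _] := Fgood X FX; apply: (up X) => //; apply/(coneX hX).
exists (U A); split => //; last by move=> x; left.
(* by maximality, adjoining v produces an element of - D; its coefficient q at v
   is not zero, since U A is disjoint from - D *)
have reach v : ~ U A v -> exists n d y (q : {poly R}),
    [/\ D d, U A y, nonneg_coef q, q != 0 & - ('X^n *: d) = y + q *: v].
  move=> nv; apply: contrapT => nex; apply: (Amax (adjoin (U A) (fun _ : 'I_1 => v))).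
    split; first by move=> x Ax; apply: adjoin_sub; right.
    by move=> /(_ v (adjoin_gen (fun _ : 'I_1 => v) ord0 hA)) Av; apply: nv; right.
  pose B := adjoin (U A) (fun _ : 'I_1 => v).
  have eU x : U B x <-> B x.
    by split=> [[x0|//]|]; [apply: adjoin_sub; left | right].
  have hB : cone B by exact: adjoin_cone.
  split.
    split; first exact/eU/(cone0 hB).
    - by move=> x y /eU hx /eU hy; apply/eU/(coneD hB).
    - by move=> c x c0 /eU hx; apply/eU/(coneC hB).
    by move=> x; rewrite !eU; exact: (coneX hB).
  move=> x /eU[n [y [q [Uy q0 e]]]] Dx; rewrite big_ord1 in e.
  apply: nex; exists n, (- x), y, (q ord0); split => //.
    apply/eqP => qz; move: e; rewrite qz scale0r addr0 => e.
    by apply: (Adisj _ Uy); rewrite -e -scalerN; exact: DX.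
  by rewrite scalerN opprK.
split=> // v; have [|nv] := pselect (U A v); first by left.
have [|nNv] := pselect (U A (- v)); first by right.
have [n [d [y [q [Dd Uy q0 qn e]]]]] := reach v nv.
have [n' [d' [y' [q' [Dd' Uy' q0' qn' e']]]]] := reach (- v) nNv.
have Uz : U A (q' *: y + q *: y').
  by apply: (coneD hA); exact: (coneZ hA).
case: (Adisj _ Uz).
have -> : - (q' *: y + q *: y') = q' *: ('X^n *: d) + q *: ('X^n' *: d').
  have h : q' *: (- ('X^n *: d)) + q *: (- ('X^n' *: d')) = q' *: y + q *: y'.
    by rewrite e e'; lmod_eq.
  by rewrite -h; lmod_eq.
by apply: DD; apply: DZ => //; exact: DX.
Qed.

End ExtendCone.

(** * Ordered spaces as polynomial modules *)
Section PolyAction.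
Variables (R : realType) (A : ovsaType R).
Implicit Types (x y : A) (g h : {poly R}) (c : R).

HB.instance Definition _ := GRing.isLinear.Build R A A *:%R (@sigma R A) (@sigma_linear R A).

Definition pact g x : A := \sum_(i < size g) g`_i *: iter i sigma x.

Lemma pact_widen n g x : (size g <= n)%N ->
  pact g x = \sum_(i < n) g`_i *: iter i sigma x.
Proof.
move=> gn; rewrite /pact (big_ord_widen _ (fun i => g`_i *: iter i sigma x) gn).
rewrite big_mkcond; apply: eq_bigr => i _; case: ltnP => // h.
by rewrite nth_default // scale0r.
Qed.

Lemma pactDl x : {morph pact^~ x : g h / g + h}.
Proof.
move=> g h; pose n := maxn (size g) (size h).
rewrite (@pact_widen n g) ?leq_maxl // (@pact_widen n h) ?leq_maxr //.
rewrite (@pact_widen n (g + h)) ?size_polyD // -big_split.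
by apply: eq_bigr => i _; rewrite coefD scalerDl.
Qed.

Lemma iter_sigma_linear n c x y :
  iter n sigma (c *: x + y) = c *: iter n sigma x + iter n sigma y.
Proof. by elim: n => //= n ->; rewrite linearP. Qed.

Lemma pactDr : right_distributive pact +%R.
Proof.
move=> g x y; rewrite /pact -big_split; apply: eq_bigr => i _.
by rewrite /= -scalerDr -[x in LHS]scale1r iter_sigma_linear scale1r.
Qed.

Lemma pactC c x : pact c%:P x = c *: x.
Proof. by rewrite (@pact_widen 1) ?size_polyC_leq1 // big_ord1 coefC. Qed.

Lemma pactMX g x : pact (g * 'X) x = sigma (pact g x).
Proof.
rewrite (@pact_widen (size g).+1 (g * 'X)); last first.
  by have [->|g0] := eqVneq g 0; rewrite ?mul0r ?size_poly0 // size_mulX.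
rewrite big_ord_recl coefMX scale0r add0r linear_sum; apply: eq_bigr => i _.
by rewrite coefMX /= linearZ.
Qed.

Lemma pactZ c g x : pact (c *: g) x = c *: pact g x.
Proof.
rewrite (@pact_widen (size g) (c *: g)) ?size_scale_leq // scaler_sumr.
by apply: eq_bigr => i _; rewrite coefZ scalerA.
Qed.

Lemma pactA g h x : pact g (pact h x) = pact (g * h) x.
Proof.
elim/poly_ind: g => [|g c IH]; first by rewrite mul0r /pact size_poly0 !big_ord0.
rewrite mulrDl !pactDl pactC mul_polyC pactZ pactMX IH; congr (_ + _).
by rewrite -pactMX mulrAC.
Qed.

Lemma pact1 : left_id 1 pact.
Proof. by move=> x; rewrite -polyC1 pactC scale1r. Qed.

End PolyAction.

(** A under another name, so that scaling by polynomials does not interfere with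
    scaling by real numbers. *)
Definition poly_module (R : realType) (A : ovsaType R) : Type := A.
HB.instance Definition _ (R : realType) (A : ovsaType R) := GRing.Zmodule.on (poly_module A).
HB.instance Definition _ (R : realType) (A : ovsaType R) :=
  GRing.Zmodule_isLmodule.Build {poly R} (poly_module A)
    (@pactA R A) (@pact1 R A) (@pactDr R A) (@pactDl R A).

(** A module in which 'X is invertible and which contains the polynomials; it is
    generated by the element that will become the new point. *)
Definition pfrac (R : realType) : Type := {fraction {poly R}}.
HB.instance Definition _ (R : realType) := GRing.Zmodule.on (pfrac R).

Section Pfrac.
Variable R : realType.
Definition pfrac_scale (g : {poly R}) (x : pfrac R) : pfrac R :=
  (tofrac g * (x : {fraction {poly R}})).

Lemma pfrac_scaleA g h x : pfrac_scale g (pfrac_scale h x) = pfrac_scale (g * h) x.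
Proof. by rewrite /pfrac_scale tofracM mulrA. Qed.

Lemma pfrac_scale1 : left_id 1 pfrac_scale.
Proof. by move=> x; rewrite /pfrac_scale tofrac1 mul1r. Qed.

Lemma pfrac_scaleDr : right_distributive pfrac_scale +%R.
Proof. by move=> g x y; rewrite /pfrac_scale mulrDr. Qed.

Lemma pfrac_scaleDl x : {morph pfrac_scale^~ x : g h / g + h}.
Proof. by move=> g h; rewrite /pfrac_scale tofracD mulrDl. Qed.

HB.instance Definition _ := GRing.Zmodule_isLmodule.Build {poly R} (pfrac R)
  pfrac_scaleA pfrac_scale1 pfrac_scaleDr pfrac_scaleDl.
End Pfrac.

(** * The quotient by a total cone *)
Section ConeQuotient.
Variables (R : realType) (E : lmodType {poly R}).
Variables (C : E -> Prop) (hC : total_cone C).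
Variable S : E -> E.
Hypothesis SX : forall m, S ('X *: m) = m.
Hypothesis XS : forall m, 'X *: S m = m.

Definition cone_null_pred (h : total_cone C) : {pred E} := fun e => `[< C e /\ C (- e) >].

Lemma cone_null_zmod : zmod_closed (cone_null_pred hC).
Proof.
split; first by apply/asboolP; rewrite oppr0; split; exact: (cone0 hC).
move=> x y /asboolP[x1 x2] /asboolP[y1 y2]; apply/asboolP; split.
  exact: (coneD hC).
by rewrite opprB addrC; apply: (coneD hC).
Qed.

HB.instance Definition _ := GRing.isZmodClosed.Build E (cone_null_pred hC) cone_null_zmod.

(** The two hypotheses are arguments of the type because the inverse of sigma on the
    quotient depends on them. *)
Definition cone_quot of (forall m, S ('X *: m) = m) & (forall m, 'X *: S m = m) : Type :=
  Quotient.quot (cone_null_pred hC : zmodClosed E).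

Local Notation Q := (cone_quot SX XS).

HB.instance Definition _ := GRing.Zmodule.on Q.

Definition cproj (e : E) : Q := \pi_(Quotient.quot (cone_null_pred hC : zmodClosed E))%qT e.
Definition crepr (x : Q) : E := @repr _ (Quotient.quot (cone_null_pred hC : zmodClosed E)) x.

Lemma creprK x : cproj (crepr x) = x.
Proof. exact: reprK. Qed.

Lemma cprojD : {morph cproj : x y / x + y}.
Proof. exact: raddfD. Qed.

Lemma cprojB : {morph cproj : x y / x - y}.
Proof. exact: raddfB. Qed.

Lemma cproj_eq0 e : C e -> C (- e) -> cproj e = 0.
Proof.
move=> h1 h2; apply/eqP; rewrite -(_ : cproj 0 = 0); last exact: raddf0.
rewrite /cproj; have := Quotient.idealrBE (cone_null_pred hC : zmodClosed E) e 0.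
by rewrite subr0 => <-; apply/asboolP.
Qed.

Lemma cproj_eq0_inv e : cproj e = 0 -> C e /\ C (- e).
Proof.
rewrite -(_ : cproj 0 = 0); last exact: raddf0.
move/eqP; have := Quotient.idealrBE (cone_null_pred hC : zmodClosed E) e 0.
by rewrite subr0 /cproj => <- /asboolP.
Qed.

Lemma crepr_cproj e : C (crepr (cproj e) - e) /\ C (e - crepr (cproj e)).
Proof.
have [] := @cproj_eq0_inv (crepr (cproj e) - e); last by rewrite opprB.
by rewrite cprojB creprK subrr.
Qed.

Definition qlift (f : E -> E) (x : Q) : Q := cproj (f (crepr x)).

Lemma qliftE (f : E -> E) : {morph f : x y / x - y} -> (forall e, C e -> C (f e)) ->
  forall e, qlift f (cproj e) = cproj (f e).
Proof.
move=> fB fC e; apply/eqP; rewrite -subr_eq0 -cprojB -fB; apply/eqP.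
have [h1 h2] := crepr_cproj e.
by apply: cproj_eq0; [exact: fC | rewrite fB opprB -fB; exact: fC].
Qed.

Definition qscale (c : R) (x : Q) : Q := cproj (c%:P *: crepr x).

Lemma cprojZ c e : cproj (c%:P *: e) = qscale c (cproj e).
Proof.
apply/eqP; rewrite -subr_eq0 /qscale -cprojB -scalerBr; apply/eqP.
have [h1 h2] := crepr_cproj e; have hN : C (- (e - crepr (cproj e))) by rewrite opprB.
apply: cproj_eq0; first exact: (cone_null _ hC).
by rewrite -scalerN opprB; apply: (cone_null _ hC) => //; rewrite opprB.
Qed.

Lemma qscaleA a b x : qscale a (qscale b x) = qscale (a * b) x.
Proof. by rewrite -[x]creprK -!cprojZ scalerA polyCM. Qed.

Lemma qscale1 : left_id 1 qscale.
Proof. by move=> x; rewrite -[x]creprK -cprojZ polyC1 scale1r. Qed.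

Lemma qscaleDr : right_distributive qscale +%R.
Proof.
by move=> a x y; rewrite -[x]creprK -[y]creprK -cprojD -!cprojZ -cprojD scalerDr.
Qed.

Lemma qscaleDl x : {morph qscale^~ x : a b / a + b}.
Proof. by move=> a b; rewrite -[x]creprK -!cprojZ -cprojD polyCD scalerDl. Qed.

HB.instance Definition _ := GRing.Zmodule_isLmodule.Build R Q
  qscaleA qscale1 qscaleDr qscaleDl.

Definition qle (x y : Q) : bool := `[< C (crepr y - crepr x) >].

Lemma qleE e e' : qle (cproj e) (cproj e') = `[< C (e' - e) >].
Proof.
have [h1 h2] := crepr_cproj e; have [h1' h2'] := crepr_cproj e'.
apply/asboolP/asboolP => h.
  have {}h := coneD hC h (coneD hC h1 h2'); lmod_exact h.
have {}h := coneD hC h (coneD hC h2 h1'); lmod_exact h.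
Qed.

Lemma qle_refl : reflexive qle.
Proof. by move=> x; apply/asboolP; rewrite subrr; exact: (cone0 hC). Qed.

Lemma qle_anti : antisymmetric qle.
Proof.
move=> x y /andP[/asboolP h1 /asboolP h2]; apply/eqP; rewrite -subr_eq0.
rewrite -[x]creprK -[y]creprK -cprojB; apply/eqP/cproj_eq0 => //.
by rewrite opprB.
Qed.

Lemma qle_trans : transitive qle.
Proof.
by move=> y x z /asboolP h1 /asboolP h2; apply/asboolP; exact: (cone_trans hC h1 h2).
Qed.

HB.instance Definition _ := Order.Le_isPOrder.Build ring_display Q qle_refl qle_anti qle_trans.

Lemma cproj_le e e' : (cproj e <= cproj e') = `[< C (e' - e) >].
Proof. exact: qleE. Qed.

Lemma cproj_lt e e' : (cproj e < cproj e') = `[< ~ C (e - e') >].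
Proof.
rewrite lt_neqAle cproj_le; apply/idP/asboolP => [/andP[/eqP ne /asboolP h] h'|h].
  apply: ne; apply/eqP; rewrite -subr_eq0 -cprojB; apply/eqP/cproj_eq0 => //.
  by rewrite opprB.
apply/andP; split; last first.
  by apply/asboolP; have [//|] := cone_total hC (e' - e); rewrite opprB.
apply/eqP => /eqP; rewrite -subr_eq0 -cprojB => /eqP /cproj_eq0_inv[h1 _]; exact: h.
Qed.

Lemma q_total : total (<=%R : rel Q).
Proof.
move=> x y; rewrite -[x]creprK -[y]creprK !cproj_le; apply/orP.
have [h|h] := cone_total hC (crepr y - crepr x); [left | right]; apply/asboolP => //.
by rewrite -opprB.
Qed.

Lemma q_ltD2r (x y z : Q) : x < y -> x + z < y + z.
Proof.
rewrite -[x]creprK -[y]creprK -[z]creprK -!cprojD !cproj_lt => /asboolP h.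
by apply/asboolP; rewrite opprD addrACA subrr addr0.
Qed.

Lemma q_scale_gt0 (c : R) (x : Q) : 0 < c -> 0 < x -> 0 < c *: x.
Proof.
move=> c0; rewrite -[x]creprK -[c *: _]cprojZ -(_ : cproj 0 = 0); last exact: raddf0.
rewrite !cproj_lt !sub0r => /asboolP h; apply/asboolP.
by rewrite -scalerN => /(coneCV hC c0).
Qed.

Lemma q_scale_lt0 (c : R) (x : Q) : 0 < c -> x < 0 -> c *: x < 0.
Proof.
move=> c0; rewrite -[x]creprK -[c *: _]cprojZ -(_ : cproj 0 = 0); last exact: raddf0.
rewrite !cproj_lt !subr0 => /asboolP h; apply/asboolP.
by move=> /(coneCV hC c0).
Qed.

HB.instance Definition _ := isOrderedVS.Build R Q q_total q_ltD2r q_scale_gt0 q_scale_lt0.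

Let SB : {morph S : x y / x - y}.
Proof. by move=> x y; rewrite -{1}[x]XS -{1}[y]XS -scalerBr SX. Qed.

Let S_cone e : C e -> C (S e).
Proof. by rewrite -{1}[e]XS => /(coneX hC). Qed.

Definition qsigma := qlift (fun e => 'X *: e).
Definition qsigmaV := qlift S.

Lemma qsigmaE e : qsigma (cproj e) = cproj ('X *: e).
Proof.
by apply: qliftE => [x y|x Cx]; [rewrite scalerBr | exact/(coneX hC)].
Qed.

Lemma qsigmaVE e : qsigmaV (cproj e) = cproj (S e).
Proof. apply: qliftE; [exact: SB | exact: S_cone]. Qed.

Lemma qsigma_linear : linear qsigma.
Proof.
move=> c x y; rewrite -[x]creprK -[y]creprK -[c *: _]cprojZ -cprojD !qsigmaE.
by rewrite -[c *: _]cprojZ -cprojD scalerDr scaler_comm.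
Qed.

Lemma qsigma_lt : {homo qsigma : x y / x < y}.
Proof.
move=> x y; rewrite -[x]creprK -[y]creprK !qsigmaE !cproj_lt => /asboolP h.
by apply/asboolP; rewrite -scalerBr (coneX hC).
Qed.

Lemma qsigmaK : cancel qsigma qsigmaV.
Proof. by move=> x; rewrite -[x]creprK qsigmaE qsigmaVE SX. Qed.

Lemma qsigmaVK : cancel qsigmaV qsigma.
Proof. by move=> x; rewrite -[x]creprK qsigmaVE qsigmaE XS. Qed.

HB.instance Definition _ := hasSigma.Build R Q qsigma_linear qsigma_lt qsigmaK qsigmaVK.

Theorem cone_quotient : exists (B : ovsaType R) (pi : E -> B),
  [/\ {morph pi : x y / x + y}, forall c e, pi (c%:P *: e) = c *: pi e,
      forall e, pi ('X *: e) = sigma (pi e) &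
      forall e e', (pi e < pi e') <-> ~ C (e - e')].
Proof.
exists Q, cproj; split.
- exact: cprojD.
- exact: cprojZ.
- by move=> e; rewrite -qsigmaE.
by move=> e e'; rewrite cproj_lt; split=> [/asboolP|h]; last exact/asboolP.
Qed.

End ConeQuotient.

(** * Extensions with a zero *)
Section OvsOrder.
Variables (R : realType) (A : ovsaType R).
Implicit Types (x y z : A).

Lemma ovs_comparable x y : (x >=< y)%O.
Proof. exact: ovs_total. Qed.

Lemma ovs_leNgt x y : (x <= y) = ~~ (y < x).
Proof. exact: comparable_leNgt (ovs_comparable _ _). Qed.

Lemma ovs_ltNge x y : (x < y) = ~~ (y <= x).
Proof. exact: comparable_ltNge (ovs_comparable _ _). Qed.

Lemma ovs_ltrD2r z x y : (x + z < y + z) = (x < y).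
Proof.
apply/idP/idP => [h|]; last exact: ovs_ltD2r.
by have := ovs_ltD2r _ _ (- z) h; rewrite !addrK.
Qed.

Lemma ovs_subr_gt0 x y : (0 < y - x) = (x < y).
Proof. by rewrite -(ovs_ltrD2r x 0) add0r subrK. Qed.

Lemma ovs_subr_ge0 x y : (0 <= y - x) = (x <= y).
Proof. by rewrite [LHS]ovs_leNgt -(ovs_ltrD2r x _ 0) add0r subrK [RHS]ovs_leNgt. Qed.

Lemma ovs_oppr_gt0 x : (0 < - x) = (x < 0).
Proof. by rewrite -sub0r ovs_subr_gt0. Qed.

Lemma ovs_addr_ge0 x y : 0 <= x -> 0 <= y -> 0 <= x + y.
Proof.
move=> x0 y0; apply: (le_trans y0); rewrite -ovs_subr_ge0.
by rewrite addrK.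
Qed.

Lemma ovs_addr_gt0 x y : 0 < x -> 0 < y -> 0 < x + y.
Proof. by move=> x0 y0; apply: (lt_trans y0); rewrite -ovs_subr_gt0 addrK. Qed.

Lemma sigma_eq0 : sigma (0 : A) = 0.
Proof. by have := linear0 (@sigma R A). Qed.

Lemma sigma_gt0 x : (0 < sigma x) = (0 < x).
Proof.
have h y : 0 < y -> 0 < sigma y by move=> /sigma_lt; rewrite sigma_eq0.
apply/idP/idP => [sx|/h//]; rewrite ovs_ltNge; apply/negP.
rewrite le_eqVlt => /predU1P[x0|].
  by rewrite x0 sigma_eq0 ltxx in sx.
by move=> /sigma_lt; rewrite sigma_eq0 => /(lt_trans sx); rewrite ltxx.
Qed.

Lemma poly_moduleC (c : R) (x : A) : (c%:P *: (x : poly_module A)) = c *: x.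
Proof. exact: pactC. Qed.

Lemma poly_moduleX (x : A) : ('X *: (x : poly_module A)) = sigma x.
Proof. by have := pactMX 1 x; rewrite mul1r pact1. Qed.

Definition nonneg (x : poly_module A) : Prop := (0 : A) <= x.

Lemma nonneg_total_cone : total_cone nonneg.
Proof.
split; first split.
- exact: lexx.
- exact: ovs_addr_ge0.
- move=> c x; rewrite /nonneg poly_moduleC le_eqVlt => /predU1P[<-|c0].
    by rewrite scale0r.
  rewrite le_eqVlt => /predU1P[<-|x0]; first by rewrite scaler0.
  by apply/ltW/ovs_scale_gt0.
- move=> x; rewrite /nonneg poly_moduleX; split.
    by rewrite !ovs_leNgt; apply: contra => x0; rewrite -sigma_eq0; exact: sigma_lt.
  by rewrite !le_eqVlt => /predU1P[<-|x0]; rewrite ?sigma_eq0 ?eqxx // sigma_gt0 x0 orbT.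
move=> x; rewrite /nonneg; have /orP[] := ovs_total (0 : A) x; first by left.
by move=> h; right; rewrite -sub0r ovs_subr_ge0.
Qed.

Lemma strictly_nonneg x : strictly nonneg x <-> 0 < x.
Proof.
rewrite /strictly /nonneg ovs_ltNge -sub0r ovs_subr_ge0.
by split=> [h|/negP//]; exact/negP.
Qed.

Lemma poly_module_sigmaV_l (x : poly_module A) : (sigmaV (('X *: x : poly_module A) : A)) = x.
Proof. by rewrite poly_moduleX sigmaK. Qed.

Lemma poly_module_sigmaV_r (x : poly_module A) : 'X *: ((sigmaV (x : A)) : poly_module A) = x.
Proof. by rewrite poly_moduleX sigmaVK. Qed.

End OvsOrder.

Section FracEmbedding.
Variable R : realType.
Implicit Types g h : {poly R}.

Definition pfrac_of g : pfrac R := tofrac g.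

Lemma pfrac_ofZ g h : g *: pfrac_of h = pfrac_of (g * h).
Proof. by rewrite /pfrac_of tofracM. Qed.

Lemma pfrac_ofD g h : pfrac_of (g + h) = pfrac_of g + pfrac_of h.
Proof. exact: tofracD. Qed.

Lemma pfrac_ofN g : pfrac_of (- g) = - pfrac_of g.
Proof. exact: tofracN. Qed.

Lemma pfrac_of0 : pfrac_of 0 = 0.
Proof. exact: tofrac0. Qed.

Lemma pfrac_of_inj : injective pfrac_of.
Proof. by move=> g h /eqP; rewrite tofrac_eq => /eqP. Qed.

Lemma pfrac_X_eq0 (x : pfrac R) : 'X *: x = 0 -> x = 0.
Proof.
move=> /eqP; rewrite [_ *: _]/(tofrac ('X : {poly R}) * (x : {fraction {poly R}})).
by rewrite mulf_eq0 tofrac_eq0 polyX_eq0 => /eqP.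
Qed.

Definition pfrac_XV (x : pfrac R) : pfrac R :=
  ((tofrac ('X : {poly R}))^-1 * (x : {fraction {poly R}})).

Lemma tofracX_neq0 : tofrac ('X : {poly R}) != 0.
Proof. by rewrite tofrac_eq0 polyX_eq0. Qed.

Lemma pfrac_XVK (x : pfrac R) : 'X *: pfrac_XV x = x.
Proof. exact: (mulVKf tofracX_neq0 (x : {fraction {poly R}})). Qed.

Lemma pfrac_XK (x : pfrac R) : pfrac_XV ('X *: x) = x.
Proof. exact: (mulKf tofracX_neq0 (x : {fraction {poly R}})). Qed.

End FracEmbedding.

Section Extension.
Variables (R : realType) (A : ovsaType R) (I : finType).
Variables (b : I -> A) (p : I -> {poly R}) (c : A).
Hypothesis c0 : 0 < c.
Hypothesis b0 : forall k, 0 < b k.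
Variable l : I.
Hypothesis bl : b l - pact (p l) c < 0.

Let E : lmodType {poly R} := (poly_module A * pfrac R)%type.
Let G : {set I} := [set k | p k != 0].
Let line k : E := (b k : poly_module A, - pfrac_of (p k)).
(* the conditions b k - p k y >= 0, b j - p j y <= 0, y <= c and 0 <= y, for the
   new point y = (0, 1) *)
Let gens (j : I) (k : I + 'I_3) : E :=
  match k with
  | inl k => if k \in G then line k else 0
  | inr k => if val k == 0%N then - line j else
             if val k == 1%N then (c : poly_module A, - pfrac_of 1) else (0, pfrac_of 1)
  end.
Let base (e : E) : Prop := nonneg e.1 /\ e.2 = 0.
Let pos (e : E) : Prop := (0 : A) < e.1 /\ e.2 = 0.

Let base_cone : cone base.
Proof.
have hA := nonneg_total_cone A; split.
- by split => //; exact: (cone0 hA).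
- by move=> x y [x1 x2] [y1 y2]; split; [exact: (coneD hA) | rewrite /= x2 y2 addr0].
- by move=> d x d0 [x1 x2]; split; [exact: (coneC hA) | rewrite /= x2 scaler0].
- move=> x; split=> -[x1 x2]; split.
  + exact/(coneX hA).
  + exact: pfrac_X_eq0.
  + exact/(coneX hA).
  by rewrite /= x2 scaler0.
Qed.

(* the two components of a relation that produces a negative element of A *)
Let certificate (j : I) (e : E) : adjoin base (gens j) e -> pos (- e) ->
  exists (a : poly_module A) (r s t : {poly R}) (q : I -> {poly R}),
    [/\ strictly (@nonneg R A) a,
     [/\ nonneg_coef r, nonneg_coef s, nonneg_coef t & forall k, nonneg_coef (q k)],
     r *: (b j : poly_module A) =
       a + \sum_(k in G) q k *: (b k : poly_module A) + s *: (c : poly_module A) &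
     r * p j = \sum_(k in G) q k * p k + s - t].
Proof.
move=> [n [y [Q [[y1 y2] Q0 e1]]]] [e0 e2].
have hA := nonneg_total_cone A.
have en : strictly (@nonneg R A) (- e.1) by exact/strictly_nonneg.
have ez : e.2 = 0 by apply/eqP; rewrite -oppr_eq0; exact/eqP.
rewrite big_sumType /= !big_ord_recl big_ord0 /= addr0 in e1.
pose i0 : 'I_3 := ord0; pose i1 : 'I_3 := lift ord0 ord0.
pose i2 : 'I_3 := lift ord0 (lift ord0 ord0).
have fst_sum (F : I -> E) : (\sum_k F k).1 = \sum_k (F k).1.
  exact: (big_morph (fun e : E => e.1) (fun _ _ => erefl) erefl).
have snd_sum (F : I -> E) : (\sum_k F k).2 = \sum_k (F k).2.
  exact: (big_morph (fun e : E => e.2) (fun _ _ => erefl) erefl).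
exists (y.1 - 'X^n *: e.1), (Q (inr i0)), (Q (inr i1)), (Q (inr i2)), (fun k => Q (inl k)).
split; first by rewrite addrC -scalerN; apply: (strictlyD hA) => //; exact/(strictlyXn n _ hA).
- by split=> // k; exact: Q0.
- have h : \sum_k (Q (inl k) *: gens j (inl k)).1 =
      \sum_(k in G) Q (inl k) *: (b k : poly_module A).
    rewrite [RHS]big_mkcond; apply: eq_bigr => k _ /=.
    by case: ifP => //= _; rewrite scaler0.
  have aux (V : lmodType {poly R}) (r s t : {poly R}) (bj u z d : V) :
    r *: bj = u - (u + (z + (r *: - bj + (s *: d + t *: 0)))) + z + s *: d by lmod_eq.
  have := congr1 fst e1; rewrite /= fst_sum h => ->; exact: (aux (poly_module A)).
have h : \sum_k (Q (inl k) *: gens j (inl k)).2 = pfrac_of (- \sum_(k in G) Q (inl k) * p k).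
  rewrite pfrac_ofN (big_morph (@pfrac_of R) (@pfrac_ofD R) (pfrac_of0 R)).
  rewrite -sumrN [RHS]big_mkcond.
  apply: eq_bigr => k _ /=; case: ifP => _ /=; last by rewrite scaler0.
  by rewrite scalerN pfrac_ofZ.
have := congr1 snd e1; rewrite /= ez scaler0 y2 add0r snd_sum h opprK.
rewrite scalerN !pfrac_ofZ -pfrac_ofN -!pfrac_ofD -[X in X = _](pfrac_of0 R) => /pfrac_of_inj.
move: (\sum_(k in G) _) => z e3.
apply/eqP; rewrite -subr_eq0; apply/eqP; apply: etrans (esym e3).
rewrite /i0 /i1 /i2; ring.
Qed.

Let consistent : exists2 j, j \in G & forall e, adjoin base (gens j) e -> ~ pos (- e).
Proof.
apply: contrapT => nex.
have cert j : exists d : poly_module A * {poly R} * {poly R} * {poly R} * (I -> {poly R}),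
    j \in G -> let: (a, r, s, t, q) := d in
    [/\ strictly (@nonneg R A) a,
     [/\ nonneg_coef r, nonneg_coef s, nonneg_coef t & forall k, nonneg_coef (q k)],
     r *: (b j : poly_module A) =
       a + \sum_(k in G) q k *: (b k : poly_module A) + s *: (c : poly_module A) &
     r * p j = \sum_(k in G) q k * p k + s - t].
  have [jG|_] := boolP (j \in G); last by exists (0, 0, 0, 0, fun=> 0).
  have [e [he hpos]] : exists e, adjoin base (gens j) e /\ pos (- e).
    apply: contrapT => ne; apply: nex; exists j => // e he hpos.
    by apply: ne; exists e.
  have [a [r [s [t [q h]]]]] := certificate he hpos.
  by exists (a, r, s, t, q).
have [d hd] := choice cert.
pose a j := (d j).1.1.1.1; pose r j := (d j).1.1.1.2.
pose s j := (d j).1.1.2; pose t j := (d j).1.2; pose q j := (d j).2.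
have {hd} h j (jG : j \in G) :
    [/\ strictly (@nonneg R A) (a j),
     [/\ nonneg_coef (r j), nonneg_coef (s j), nonneg_coef (t j) & forall k, nonneg_coef (q j k)],
     r j *: (b j : poly_module A) =
       a j + \sum_(k in G) q j k *: (b k : poly_module A) + s j *: (c : poly_module A) &
     r j * p j = \sum_(k in G) q j k * p k + s j - t j].
  by have := hd j jG; rewrite /a /r /s /t /q; case: (d j) => [[[[? ?] ?] ?] ?].
have lG : l \in G.
  rewrite inE; apply/eqP => pl; move: bl; rewrite pl /pact size_poly0 big_ord0 subr0.
  by move/(lt_trans (b0 l)); rewrite ltxx.
have key : strictly (@nonneg R A) ((b l : poly_module A) - p l *: (c : poly_module A)); last first.
  by move/strictly_nonneg: key => /(lt_trans bl); rewrite ltxx.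
apply: (@certificate_strictly _ _ _ (nonneg_total_cone A) (@sigmaV R A)
  (@poly_module_sigmaV_l R A) (@poly_module_sigmaV_r R A) I G
  r s t p q a (b : I -> poly_module A) (c : poly_module A))
  => //.
- by move=> j k jG _; have [_ [_ _ _ q0] _ _] := h j jG.
- by move=> j jG; have [_ [_ s0 _ _] _ _] := h j jG; exact: nonneg_coef_nnp.
- by move=> j jG; have [_ [_ _ t0 _] _ _] := h j jG; exact: nonneg_coef_nnp.
- by move=> j; rewrite inE.
- by move=> j jG; have [] := h j jG.
- by move=> j _; apply/strictly_nonneg.
- by apply/strictly_nonneg.
- by move=> j jG; have [] := h j jG.
- by move=> j jG; have [] := h j jG.
Qed.

Let Einv (e : E) : E := (sigmaV (e.1 : A) : poly_module A, pfrac_XV e.2).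

Let Einv_l e : Einv ('X *: e) = e.
Proof. by case: e => x y; rewrite /Einv /= poly_module_sigmaV_l pfrac_XK. Qed.

Let Einv_r e : 'X *: Einv e = e.
Proof.
case: e => x y; rewrite /Einv /=; apply: (f_equal2 pair (poly_module_sigmaV_r x)).
exact: pfrac_XVK.
Qed.

(** The strict bounds on y come for free: y = 0 would give b j = 0, and y = c would
    make b l - p l y negative. *)
Theorem extension_with_zero : exists (B : ovsaType R) (i : A -> B),
  is_embedding i /\ exists y : B, [/\ 0 < y < i c,
    forall k, 0 <= i (b k) - pact (p k) y & exists k, i (b k) - pact (p k) y = 0].
Proof.
have [j jG disj] := consistent.
have hA := nonneg_total_cone A.
have [C [hC C0 Cpos]] : exists C, [/\ total_cone C, forall e, adjoin base (gens j) e -> C e &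
    forall e, C e -> ~ pos (- e)].
  apply: total_cone_exists => //; first exact: adjoin_cone.
    by move=> x y [x1 x2] [y1 y2]; split; [exact: ovs_addr_gt0 | rewrite /= x2 y2 addr0].
  move=> q x q0 qn [x1 x2]; split; last by rewrite /= x2 scaler0.
  apply/strictly_nonneg.
  apply: (posp_strictly hA (@poly_module_sigmaV_l R A) (@poly_module_sigmaV_r R A)).
    exact: (nnp_posp (nonneg_coef_nnp q0)).
  exact/strictly_nonneg.
have [B [pi [piD piC piX pilt]]] := cone_quotient hC Einv_l Einv_r.
pose emb (x : A) : E := (x : poly_module A, 0).
pose i x : B := pi (emb x).
have pi0 : pi 0 = 0 by apply: (addrI (pi 0)); rewrite -piD !addr0.
have piN e : pi (- e) = - pi e.
  by apply/eqP; rewrite -addr_eq0 -piD addNr pi0.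
have pig (g : {poly R}) e : pi (g *: e) = pact g (pi e).
  elim/poly_ind: g e => [|g d IH] e.
    by rewrite scale0r pi0 /pact size_poly0 big_ord0.
  by rewrite scalerDl mulrC -scalerA piD piX piC IH pactDl pactC mulrC pactMX.
have pige e : C e -> 0 <= pi e.
  move=> Ce; rewrite ovs_leNgt -pi0; apply/negP => /pilt; rewrite subr0; exact.
have ilt : {mono i : x y / x < y}.
  move=> x y; apply/idP/idP => [/pilt nC|xy].
    rewrite ovs_ltNge; apply/negP => yx; apply: nC; apply/C0/adjoin_sub.
    by split; rewrite /= ?subrr // /nonneg ovs_subr_ge0.
  apply/pilt => /Cpos; apply; split; last by rewrite /= subrr oppr0.
  by rewrite /= opprB ovs_subr_gt0.
have iD x y : i (x + y) = i x + i y.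
  by rewrite /i -piD; congr (pi _); rewrite /emb; congr pair; rewrite addr0.
have iC d x : i (d *: x) = d *: i x.
  rewrite /i -piC; congr (pi _); rewrite /emb -[in LHS]poly_moduleC.
  by apply: (f_equal2 pair); rewrite //= scaler0.
have iX x : i (sigma x) = sigma (i x).
  rewrite /i -piX; congr (pi _); rewrite /emb -[in LHS]poly_moduleX.
  by apply: (f_equal2 pair); rewrite //= scaler0.
exists B, i; split.
  split=> //; first by move=> d x y; rewrite iD iC.
  by move=> x; rewrite -{2}[x]sigmaVK iX sigmaK.
pose y := pi (0, pfrac_of 1).
have lineE k : pi (line k) = i (b k) - pact (p k) y.
  rewrite /y -pig -piN -piD; congr (pi _).
  by apply: (f_equal2 pair); rewrite /= ?scaler0 ?subr0 // pfrac_ofZ mulr1 add0r.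
have gen k : C (gens j k) by apply/C0/adjoin_gen.
have fG k : k \in G -> 0 <= i (b k) - pact (p k) y.
  by move=> kG; rewrite -lineE; apply: pige; have := gen (inl k); rewrite /= kG.
have ib k : 0 < i (b k) by rewrite -(_ : i 0 = 0) ?ilt.
have f0 k : 0 <= i (b k) - pact (p k) y.
  have [/fG//|] := boolP (k \in G); rewrite inE negbK => /eqP ->.
  by rewrite /pact size_poly0 big_ord0 subr0 ltW.
have fj : i (b j) - pact (p j) y = 0.
  apply: le_anti; rewrite f0 andbT -ovs_subr_ge0 sub0r -lineE -piN.
  by apply: pige; exact: (gen (inr ord0)).
have y0 : 0 <= y by apply: pige; exact: (gen (inr (lift ord0 (lift ord0 ord0)))).
have yc : y <= i c.
  rewrite -ovs_subr_ge0 /y -piN -piD; have := pige _ (gen (inr (lift ord0 ord0))).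
  by congr (0 <= pi _); apply: (f_equal2 pair); rewrite /= ?subr0 ?sub0r ?oppr0 ?addr0 ?add0r.
exists y; split; [|by []|by exists j].
rewrite !lt_neqAle y0 yc !andbT; apply/andP; split; apply/eqP => ye.
  have := ib j; move: fj; rewrite -ye -pi0 -pig scaler0 pi0 subr0 => ->.
  by rewrite ltxx.
have := f0 l; rewrite ye -[i c]/(pi (emb c)) -pig ovs_leNgt => /negP; apply.
have -> : pi (p l *: emb c) = i (pact (p l) c).
  by congr (pi _); apply: (f_equal2 pair); rewrite //= scaler0.
have iN x : i (- x) = - i x.
  by apply/eqP; rewrite -addr_eq0 -iD addNr /i -[emb 0]/(0 : E) pi0.
by rewrite -iN -iD -(_ : i 0 = 0) ?ilt.
Qed.

End Extension.

(** * Sigma-polynomials *)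
Section SigmaPolynomials.
Variables (R : realType) (A : ovsaType R).
Implicit Types (f : sigma_poly R A) (x y w : A).

Definition sp_poly (T : Type) (f : sigma_poly R T) : {poly R} :=
  \poly_(j < (sp_deg f).+1) @sp_coef _ _ f (inord j).

Lemma sp_evalE f x : sp_eval f x = sp_const f + pact (sp_poly f) x.
Proof.
rewrite /sp_eval (@pact_widen _ _ (sp_deg f).+1) ?size_poly //; congr (_ + _).
by apply: eq_bigr => j _; rewrite coef_poly ltn_ord inord_val.
Qed.

Lemma sp_eval_shift f x y : sp_eval f (x + y) = sp_eval f x + pact (sp_poly f) y.
Proof. by rewrite !sp_evalE pactDr addrA. Qed.

Lemma pactNl (g : {poly R}) x : pact (- g) x = - pact g x.
Proof. exact: (scaleNr g (x : poly_module A)). Qed.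

Lemma pactNr (g : {poly R}) x : pact g (- x) = - pact g x.
Proof. exact: (scalerN g (x : poly_module A)). Qed.

Lemma min_spP n (f : 'I_n.+1 -> sigma_poly R A) x :
  (forall k, min_sp f x <= sp_eval (f k) x) /\
  exists k, min_sp f x = sp_eval (f k) x.
Proof.
pose F k := sp_eval (f k) x.
have minP (u v : A) : [/\ Order.min u v <= u, Order.min u v <= v &
    Order.min u v = u \/ Order.min u v = v] :> Prop.
  rewrite minElt; case: ifP => [uv|/negbT]; first by split; [|exact: ltW | left].
  by rewrite -ovs_leNgt => vu; split; [| | right].
have [h1 h2] : (forall k, k \in index_enum 'I_n.+1 ->
    \big[Order.min/F ord0]_(j <- index_enum 'I_n.+1) F j <= F k) /\
    exists k, \big[Order.min/F ord0]_(j <- index_enum 'I_n.+1) F j = F k.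
  elim: (index_enum _) => [|j s [IH1 [k IH2]]].
    by split=> //; exists ord0; rewrite big_nil.
  rewrite big_cons; set m := \big[_/_]_(j <- s) _.
  have [m1 m2 m3] := minP (F j) m; split.
    by move=> k'; rewrite inE => /predU1P[->//|/IH1]; exact: le_trans.
  by case: m3 => ->; [exists j | exists k].
by split=> // k; apply: h1; exact: mem_index_enum.
Qed.

Lemma min_sp_eq n (f : 'I_n.+1 -> sigma_poly R A) x w :
  min_sp f x = w <-> (forall k, w <= sp_eval (f k) x) /\ exists k, sp_eval (f k) x = w.
Proof.
have [h1 [k h2]] := min_spP f x; split=> [<-|[h3 [l h4]]]; first by split=> //; exists k.
by apply: le_anti; rewrite -{1}h4 h1 h2 h3.
Qed.

Lemma min_sp_gt0 n (f : 'I_n.+1 -> sigma_poly R A) x :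
  0 < min_sp f x -> forall k, 0 < sp_eval (f k) x.
Proof. by move=> h k; apply: (lt_le_trans h); case: (min_spP f x). Qed.

Lemma min_sp_lt0 n (f : 'I_n.+1 -> sigma_poly R A) x :
  min_sp f x < 0 -> exists k, sp_eval (f k) x < 0.
Proof. by have [_ [k ->]] := min_spP f x; exists k. Qed.

End SigmaPolynomials.

Lemma embedding_pact (R : realType) (A B : ovsaType R) (i : A -> B) g x :
  is_embedding i -> i (pact g x) = pact g (i x).
Proof.
move=> [il _ iS _]; have iD u v : i (u + v) = i u + i v.
  by have := il 1 u v; rewrite !scale1r.
have i0 : i 0 = 0 by apply: (addrI (i 0)); rewrite -iD !addr0.
have iC c u : i (c *: u) = c *: i u by have := il c u 0; rewrite !addr0 i0 addr0.
elim/poly_ind: g => [|g c IH]; first by rewrite /pact size_poly0 !big_ord0 i0.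
by rewrite !pactDl !pactC !pactMX iD iC iS IH.
Qed.

Lemma embedding_sp_eval (R : realType) (A B : ovsaType R) (i : A -> B) f x :
  is_embedding i -> sp_eval (sp_map i f) (i x) = i (sp_eval f x).
Proof.
move=> hi; rewrite !sp_evalE /= -(embedding_pact _ _ hi).
have [il _ _ _] := hi.
by have := il 1 (sp_const f) (pact (sp_poly f) x); rewrite !scale1r => ->.
Qed.

(** The new point y is the distance from the end point where the minimum is
    positive; it is measured leftwards from b, with slopes p, or rightwards from
    a, with slopes - p. *)
Theorem sign_change_zero (R : realType) (A : ovsaType R) n
    (f : 'I_n.+1 -> sigma_poly R A) (a b : A) :
  a < b -> changes_sign (min_sp f) a b ->
  exists (B : ovsaType R) (i : A -> B),
    is_embedding i /\
    exists z : B, i a < z < i b /\ min_sp (fun j => sp_map i (f j)) z = 0.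
Proof.
move=> ab; have c0 : 0 < b - a by rewrite ovs_subr_gt0.
have iB (B : ovsaType R) (i : A -> B) (hi : is_embedding i) : i (b - a) = i b - i a.
  have [il _ _ _] := hi; have := il (-1) a b.
  by rewrite !scaleN1r [b - a]addrC => ->; rewrite addrC.
case=> [[ha hb]|[ha hb]].
- have [l fl] := min_sp_lt0 hb.
  have [|B [i [hi [y [/andP[y0 yc] yge [k yk]]]]]] :=
    @extension_with_zero _ A _ (fun k => sp_eval (f k) a) (fun k => - sp_poly (f k))
      (b - a) c0 (min_sp_gt0 ha) l.
    by rewrite pactNl opprK -sp_eval_shift addrC subrK.
  have E j : sp_eval (sp_map i (f j)) (i a + y) =
      i (sp_eval (f j) a) - pact (- sp_poly (f j)) y.
    by rewrite sp_eval_shift embedding_sp_eval // pactNl opprK.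
  exists B, i; split=> //; exists (i a + y); split; last first.
    by apply/min_sp_eq; split=> [j|]; [rewrite E | exists k; rewrite E].
  apply/andP; split; first by rewrite -ovs_subr_gt0 addrC addKr.
  by rewrite -ovs_subr_gt0 opprD addrA -iB // ovs_subr_gt0.
have [l fl] := min_sp_lt0 ha.
have [|B [i [hi [y [/andP[y0 yc] yge [k yk]]]]]] :=
  @extension_with_zero _ A _ (fun k => sp_eval (f k) b) (fun k => sp_poly (f k))
    (b - a) c0 (min_sp_gt0 hb) l.
  by rewrite -pactNr -sp_eval_shift opprB addrC subrK.
have E j : sp_eval (sp_map i (f j)) (i b - y) =
    i (sp_eval (f j) b) - pact (sp_poly (f j)) y.
  by rewrite sp_eval_shift embedding_sp_eval // pactNr.
exists B, i; split=> //; exists (i b - y); split; last first.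
  by apply/min_sp_eq; split=> [j|]; [rewrite E | exists k; rewrite E].
apply/andP; split; last by rewrite -ovs_subr_gt0 opprB addrC subrK.
by rewrite -ovs_subr_gt0 addrAC -iB // ovs_subr_gt0.
Qed.

(** * Existential closure *)
Section Formula.
Variables (R : realType) (X : Type).
Implicit Types (ts : seq (term R X)) (fs : seq (qf_formula R X)).

Definition FTrue : qf_formula R X := FEq (TZero R X) (TZero R X).
Definition tsum := foldr (@TAdd R X) (TZero R X).
Definition fall := foldr (@FAnd R X) FTrue.
Definition fany := foldr (@FOr R X) (FNot FTrue).

Variables (A : ovsaType R) (e : X -> A).

Lemma tsum_eval ts : term_eval e (tsum ts) = \sum_(t <- ts) term_eval e t.
Proof. by elim: ts => [|t ts IH] /=; rewrite ?big_nil // big_cons IH. Qed.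

Lemma fall_holds (I : finType) (F : I -> qf_formula R X) :
  qf_holds e (fall [seq F k | k <- enum I]) <-> forall k, qf_holds e (F k).
Proof.
suff h (s : seq I) : qf_holds e (fall [seq F k | k <- s]) <->
    forall k, k \in s -> qf_holds e (F k).
  by rewrite h; split=> H k; [apply: H; rewrite mem_enum | move=> _; exact: H].
elim: s => [|j s IH] /=; first by split.
rewrite IH; split=> [[Fj Fs] k|H]; first by rewrite inE => /predU1P[->//|]; exact: Fs.
by split=> [|k ks]; apply: H; rewrite inE ?eqxx // ks orbT.
Qed.

Lemma fany_holds (I : finType) (F : I -> qf_formula R X) :
  qf_holds e (fany [seq F k | k <- enum I]) <-> exists k, qf_holds e (F k).
Proof.
suff h (s : seq I) : qf_holds e (fany [seq F k | k <- s]) <->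
    exists2 k, k \in s & qf_holds e (F k).
  by rewrite h; split=> [[k _]|[k Fk]]; exists k => //; rewrite mem_enum.
elim: s => [|j s IH] /=; first by split=> [/(_ erefl)|[]].
rewrite IH; split=> [[Fj|[k ks Fk]]|[k]].
- by exists j; rewrite ?mem_head.
- by exists k; rewrite // inE ks orbT.
by rewrite inE => /predU1P[->|ks] Fk; [left | right; exists k].
Qed.

Definition sp_term (T : Type) (f : sigma_poly R T) (d x : X) : term R X :=
  TAdd (TVar R d)
    (tsum [seq TScale (@sp_coef _ _ f j) (iter j (@TSigma R X) (TVar R x))
          | j <- enum 'I_(sp_deg f).+1]).

Lemma sp_term_eval (T : Type) (f : sigma_poly R T) (d x : X) :
  term_eval e (sp_term f d x) = sp_eval (sp_map (fun=> e d) f) (e x).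
Proof.
rewrite /sp_eval /= tsum_eval big_map big_enum; congr (_ + _).
apply: eq_bigr => j _ /=; congr (_ *: _).
by elim: (nat_of_ord j) => //= m ->.
Qed.

End Formula.

Section ZeroFormula.
Variables (R : realType) (M : ovsaType R) (n : nat) (f : 'I_n.+1 -> sigma_poly R M).

(* the parameters are the constants of the polynomials, then the two end points *)
Let par (k : 'I_n.+1) : 'I_n.+3 + 'I_1 := inl (inord k).
Let lo : 'I_n.+3 + 'I_1 := inl (inord n.+1).
Let hi : 'I_n.+3 + 'I_1 := inl (inord n.+2).
Let unk : 'I_n.+3 + 'I_1 := inr ord0.

Definition zero_formula : qf_formula R ('I_n.+3 + 'I_1) :=
  FAnd (FAnd (FLt (TVar R lo) (TVar R unk)) (FLt (TVar R unk) (TVar R hi)))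
    (FAnd (fall [seq FNot (FLt (sp_term (f k) (par k) unk) (TZero R _)) | k <- enum 'I_n.+1])
          (fany [seq FEq (sp_term (f k) (par k) unk) (TZero R _) | k <- enum 'I_n.+1])).

Definition zero_params (a b : M) : n.+3.-tuple M :=
  [tuple if (k < n.+1)%N then sp_const (f (inord k)) else if k == n.+1 :> nat then a else b
   | k < n.+3].

Lemma zero_formulaP (B : ovsaType R) (i : M -> B) (a b : M) (y : 1.-tuple B) :
  qf_holds (env (map_tuple i (zero_params a b)) y) zero_formula <->
  i a < tnth y ord0 < i b /\ min_sp (fun k => sp_map i (f k)) (tnth y ord0) = 0.
Proof.
rewrite min_sp_eq /= fall_holds fany_holds.
set e := env _ _.
have epar k : e (par k) = i (sp_const (f k)).
  have k3 : (k < n.+3)%N by rewrite (ltn_trans (ltn_ord k)) // ltnS leqnSn.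
  rewrite /e /= tnth_map tnth_mktuple inordK // ltn_ord.
  by congr (i (sp_const (f _))); apply: val_inj; rewrite /= !inordK.
have E k : term_eval e (sp_term (f k) (par k) unk) = sp_eval (sp_map i (f k)) (tnth y ord0).
  by rewrite sp_term_eval epar.
have elo : tnth (map_tuple i (zero_params a b)) (inord n.+1) = i a.
  by rewrite tnth_map tnth_mktuple inordK // ltnn eqxx.
have ehi : tnth (map_tuple i (zero_params a b)) (inord n.+2) = i b.
  by rewrite tnth_map tnth_mktuple inordK // ltnNge leqnSn /= eqn_leq ltnn.
rewrite elo ehi; split.
  move=> [[-> ->] [h1 [k h2]]]; split=> //; split.
    by move=> l; rewrite -E ovs_leNgt; apply/negP/h1.
  by exists k; rewrite -E.
move=> [/andP[-> ->] [h1 [k h2]]]; split=> //; split; last by exists k; exact: etrans (E k) h2.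
by move=> l; apply/negP; have := h1 l; rewrite -E ovs_leNgt.
Qed.

End ZeroFormula.

Theorem existentially_closed_IVP (R : realType) (M : ovsaType R) n
    (f : 'I_n.+1 -> sigma_poly R M) : existentially_closed M -> IVP (min_sp f).
Proof.
move=> ec D cD X Y w [x Dx <-] [y Dy <-] /andP[xw wy].
have idE : is_embedding (@idfun M) by split.
pose g k := SigmaPoly (@sp_coef _ _ (f k)) (sp_const (f k) - w).
have gE k u : sp_eval (g k) u = sp_eval (f k) u - w by rewrite /sp_eval /= addrAC.
have [hx [kx ex]] := min_spP f x; have [hy [ky ey]] := min_spP f y.
have gmin u : min_sp g u = min_sp f u - w.
  have [h1 [k h2]] := min_spP f u; apply/min_sp_eq; split=> [l|].
    by rewrite gE -ovs_subr_ge0 opprB addrA subrK ovs_subr_ge0.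
  by exists k; rewrite gE h2.
move: xw; rewrite le_eqVlt => /predU1P[<-|xw]; first by exists x.
move: wy; rewrite le_eqVlt => /predU1P[->|wy]; first by exists y.
have gx : min_sp g x < 0 by rewrite gmin -ovs_oppr_gt0 opprB ovs_subr_gt0.
have gy : 0 < min_sp g y by rewrite gmin ovs_subr_gt0.
have main a b : D a -> D b -> a < b -> changes_sign (min_sp g) a b ->
    image D (min_sp f) w.
  move=> Da Db ab /(sign_change_zero ab)[B [i [hi [z [zab zz]]]]].
  have [|m] := ec _ _ (zero_formula g) (zero_params g a b).
    exists B, i; split=> //; exists [tuple of [:: z]].
    by apply/zero_formulaP; have -> : tnth [tuple of [:: z]] ord0 = z by [].
  have -> : zero_params g a b = map_tuple id (zero_params g a b).
    by apply: val_inj; rewrite /= map_id.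
  move=> /zero_formulaP[/andP[/ltW am /ltW mb] m0].
  exists (tnth m ord0); first by apply: (cD a b) => //; rewrite am.
  apply/eqP; rewrite -subr_eq0 -gmin; apply/eqP; rewrite -[RHS]m0.
  by apply/esym/min_sp_eq; have /min_sp_eq := erefl (min_sp g (tnth m ord0)).
have [xy|yx] := boolP (x < y); first by apply: (main x y) => //; right.
apply: (main y x) => //; last by left.
rewrite lt_neqAle -[y <= x]negbK -ovs_ltNge yx andbT; apply/eqP => yx'.
by move: gx gy; rewrite yx' => /lt_trans h /h; rewrite ltxx.
Qed.

Theorem theorem4p13 (R : realType) :
  (forall (A : ovsaType R) (n : nat) (f : 'I_n.+1 -> sigma_poly R A) (a b : A),
     a < b -> changes_sign (min_sp f) a b ->
     exists (B : ovsaType R) (i : A -> B),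
       is_embedding i /\
       exists z : B,
         i a < z < i b /\ min_sp (fun j => sp_map i (f j)) z = 0)
  /\
  (forall M : ovsaType R, existentially_closed M ->
     forall (n : nat) (f : 'I_n.+1 -> sigma_poly R M), IVP (min_sp f)).
Proof.
split=> [A n f a b|M ec n f]; first exact: sign_change_zero.
exact: existentially_closed_IVP.
Qed.
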